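(* Let $\alpha=\{\alpha_k\}_{k\in\mathbb{Z}}\subset\mathbb{D}$ and let $k_0\in\mathbb{Z}$. Let $U$ be the full-lattice CMV operator on $\ell^2(\mathbb{Z})$ associated with $\alpha$, and let $g(z,k)$, $h(z,k)$ ($z\in\mathbb{D}$, $k\in\mathbb{Z}$) be the diagonal and neighboring off-diagonal entries of the Green's function of $U$, as defined in the context. Then any of the following two sets of data (i) $g(z,k_0)$ and $h(z,k_0)$ for all $z$ in a sufficiently small neighborhood of the origin, under the assumption $h(0,k_0)\neq 0$; (ii) $g(z,k_0-1)$ and $g(z,k_0)$ for all $z$ in a sufficiently small neighborhood of the origin, and $\alpha_{k_0}$, under the assumption $\alpha_{k_0}\neq 0$; uniquely determines the Verblunsky coefficients $\{\alpha_k\}_{k\in\mathbb{Z}}$, and hence the full-lattice CMV operator $U$. (That is: if two sequences $\alpha^{(1)},\alpha^{(2)}\subset\mathbb{D}$ both satisfy the assumption in (i) and have the same data (i) on some open neighborhood of $0$ in $\mathbb{D}$, or both satisfy the assumption in (ii) and have the same data (ii) on some open neighborhood of $0$ in $\mathbb{D}$, then $\alpha^{(1)}_k=\alpha^{(2)}_k$ for all $k\in\mathbb{Z}$.)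
   Context: $\mathbb{D}$ denotes the open unit disk in $\mathbb{C}$. $\ell^2(\mathbb{Z})$ is the Hilbert space of square summable complex-valued sequences with standard basis $\{\delta_k\}_{k\in\mathbb{Z}}$; for a bounded operator $A$ on $\ell^2(\mathbb{Z})$, $A(k,k')=A_{k,k'}=(\delta_k,A\delta_{k'})_{\ell^2(\mathbb{Z})}$ denotes its matrix entries (row $k$, column $k'$), the scalar product being linear in the second argument. Given $\alpha=\{\alpha_k\}_{k\in\mathbb{Z}}\subset\mathbb{D}$ (the Verblunsky coefficients), set $\rho_k=\sqrt{1-|\alpha_k|^2}$ and define the unitary $2\times 2$ matrices $$\Theta_k=\begin{pmatrix}-\alpha_k&\rho_k\\ \rho_k&\overline{\alpha_k}\end{pmatrix},\quad k\in\mathbb{Z}.$$ Let $V$ and $W$ be the unitary block diagonal operators on $\ell^2(\mathbb{Z})$ whose $2\times 2$ diagonal blocks are, for $k\in\mathbb{Z}$, $$\begin{pmatrix}V_{2k-1,2k-1}&V_{2k-1,2k}\\ V_{2k,2k-1}&V_{2k,2k}\end{pmatrix}=\Theta_{2k},\qquad \begin{pmatrix}W_{2k,2k}&W_{2k,2k+1}\\ W_{2k+1,2k}&W_{2k+1,2k+1}\end{pmatrix}=\Theta_{2k+1},$$ all other matrix entries being zero. The full-lattice CMV operator associated with $\alpha$ is the unitary operator $U=VW$ on $\ell^2(\mathbb{Z})$. For $z\in\mathbb{D}$ and $k\in\mathbb{Z}$ define $$g(z,k)=(U-zI)^{-1}(k,k),\qquad h(z,k)=\begin{cases}(U-zI)^{-1}(k-1,k),&k\text{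 odd},\\ (U-zI)^{-1}(k,k-1),&k\text{ even}.\end{cases}$$ *)

(* Defs.v *)
From HB Require Import structures.
From mathcomp Require Import all_boot all_order all_algebra.
From mathcomp Require Import finmap complex.
From mathcomp Require Import all_classical all_reals all_analysis.
From mathcomp Require Import zify ring lra.
From mathcomp Require summability.

Set Implicit Arguments.
Unset Strict Implicit.
Unset Printing Implicit Defensive.

Import Order.TTheory GRing.Theory Num.Theory.
Import numFieldNormedType.Exports.

Local Open Scope classical_set_scope.
Local Open Scope ring_scope.

Definition evenz (k : int) : bool := (2 %| k)%Z.

Record unit_disk (R : realType) := UnitDisk {
  disk_val :> R[i];
  disk_lt1 : `|disk_val| < 1 }.

HB.instance Definition _ (R : realType) := [isSub for @disk_val R].

Section SquareSummable.
Variable R : realType.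
Implicit Types (f g c : int -> R[i]) (k : int).

Definition square_summable : {pred int -> R[i]} :=
  fun f => summable [set: int] (fun k => (Normc.normc (f k) ^+ 2)%:E).

Let nrm2 f k : \bar R := (Normc.normc (f k) ^+ 2)%:E.

Let nrm2_ge0 f k : (0 <= nrm2 f k)%E.
Proof. by rewrite lee_fin sqr_ge0. Qed.

Let square_summableE f :
  (f \in square_summable) = (\esum_(k in [set: int]) nrm2 f k < +oo)%E.
Proof.
rewrite unfold_in /square_summable /summable; congr (_ < _)%E.
by apply: eq_esum => k _; rewrite gee0_abs// nrm2_ge0.
Qed.

Let normc_ge0 (x : R[i]) : 0 <= Normc.normc x.
Proof. by case: x => a b; exact: sqrtr_ge0. Qed.

Let square_summable_le f g : (forall k, `|f k| <= `|g k|) ->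
  g \in square_summable -> f \in square_summable.
Proof.
move=> fg; rewrite !square_summableE; apply: le_lt_trans.
apply: le_esum => k _; rewrite lee_fin lerXn2r// ?nnegrE//.
by have := fg k; rewrite -lecR.
Qed.

Lemma square_summableD f g : f \in square_summable -> g \in square_summable ->
  f + g \in square_summable.
Proof.
rewrite !square_summableE => sf sg.
apply: (@le_lt_trans _ _ (\esum_(k in [set: int])
  ((nrm2 f k + nrm2 f k) + (nrm2 g k + nrm2 g k)))%E).
  apply: le_esum => k _; rewrite -!EFinD lee_fin.
  have /(@lerXn2r _ 2)/= : Normc.normc (f k + g k) <=
      Normc.normc (f k) + Normc.normc (g k) by exact: le_normcD.
  rewrite !nnegrE addr_ge0// => /(_ (normc_ge0 _) isT) /le_trans; apply.
  have := sqr_ge0 (Normc.normc (f k) - Normc.normc (g k)); lra.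
by rewrite !esumD// ?lte_add_pinfty// => k _; exact: adde_ge0.
Qed.

Lemma square_summableZ (a : R[i]) f :
  f \in square_summable -> a *: f \in square_summable.
Proof.
move=> sf; pose n := (Num.truncn (Normc.normc a)).+1.
have sn : f *+ n \in square_summable.
  elim: n => [|n IH]; last by rewrite mulrS square_summableD.
  rewrite mulr0n square_summableE (_ : esum _ _ = 0)%E ?ltry//.
  by apply: esum1 => k _; rewrite /nrm2 Normc.normc0 expr0n.
apply: square_summable_le sn => k.
have -> : (f *+ n) k = n%:R * f k.
  by rewrite mulr_natl; elim: (n) => [//|m IH]; rewrite !mulrS -IH.
rewrite [(a *: f) k]/(a * f k) !normrM ler_wpM2r// normr_nat.
have -> : `|a| = (Normc.normc a)%:C%C by [].
have -> : n%:R = (n%:R : R)%:C%C by rewrite rmorph_nat.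
by rewrite lecR ltW// truncnS_gt.
Qed.

Lemma square_summable_submod_closed : submod_closed square_summable.
Proof.
split.
  rewrite square_summableE (_ : esum _ _ = 0)%E ?ltry//.
  by apply: esum1 => k _; rewrite /nrm2 Normc.normc0 expr0n.
move=> a f g sf sg.
by apply: square_summableD => //; exact: square_summableZ.
Qed.

HB.instance Definition _ := GRing.isSubmodClosed.Build _ _ square_summable
  square_summable_submod_closed.

Lemma square_summable_shift (d : int) f :
  f \in square_summable -> (fun k => f (k + d)) \in square_summable.
Proof.
rewrite !square_summableE => /(le_lt_trans _); apply; rewrite le_eqVlt.
apply/orP; left; apply/eqP; symmetry.
rewrite [LHS](@reindex_esum _ _ _ [set: int] [set: int] (fun k => k + d))//.
split=> //.
- by move=> x y _ _ /addIr.
- by move=> k _; exists (k - d); rewrite // subrK.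
Qed.

Lemma square_summableM c f : (forall k, `|c k| <= 1) ->
  f \in square_summable -> (fun k => c k * f k) \in square_summable.
Proof.
move=> c1; apply: square_summable_le => k.
by rewrite normrM ler_piMl.
Qed.

Lemma square_summable_delta k :
  (fun j => (j == k)%:R : R[i]) \in square_summable.
Proof.
rewrite square_summableE.
have -> : \esum_(j in [set: int]) nrm2 (fun j => (j == k)%:R) j =
    \esum_(j in [set k]) (1%:E : \bar R).
  rewrite [RHS]esum_mkcond; apply: eq_esum => j _.
  rewrite in_set1 /nrm2; case: eqP => _.
    by rewrite Normc.normc1 expr1n.
  by rewrite Normc.normc0 expr0n.
by rewrite esum_set1 ?lee01 ?ltry// lee_fin.
Qed.

End SquareSummable.

Section Ell2.
Variable R : realType.

Record ell2 := Ell2 {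
  ell2_val :> int -> R[i];
  ell2P : ell2_val \in @square_summable R }.

HB.instance Definition _ := [isSub for ell2_val].
HB.instance Definition _ := [Choice of ell2 by <:].
HB.instance Definition _ := [SubChoice_isSubLmodule of ell2 by <:].
HB.instance Definition _ := isPointed.Build ell2 0.

(* The sum over the integers is the unconditional one, i.e. the limit of the
   finite partial sums along the directed set of finite subsets. *)
Definition ell2_dot (f g : ell2) : R[i] :=
  summability.sum (fun k : int => (f k)^* * g k : R[i]^o).

Definition delta (k : int) : ell2 := Ell2 (square_summable_delta R k).

Definition entry (A : ell2 -> ell2) (k k' : int) : R[i] :=
  ell2_dot (delta k) (A (delta k')).

(* (A - z I)^-1, with a default value if A - z I is not bijective on ell2;
   by the bounded inverse theorem, the inverse of a bounded bijective operator
   is automatically bounded. *)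
Definition resolvent (A : ell2 -> ell2) (z : R[i]) : ell2 -> ell2 :=
  let Az f := A f - z *: f in
  get [set B : ell2 -> ell2 | cancel B Az /\ cancel Az B].

Lemma entryE (A : ell2 -> ell2) k k' : entry A k k' = A (delta k') k.
Proof.
pose F : int -> R[i]^o := fun j => (delta k j)^* * A (delta k') j.
rewrite /entry /ell2_dot /summability.sum -/F.
apply: (@norm_cvg_lim _ (R[i]^o) _
  (fmap_proper_filter _ summability.totally_filter)).
have FF : Filter (@summability.totally int).
  by apply: (@filter_filter _ _ summability.totally_filter).
apply: cvg_near_cst.
exists [fset k]%fset => //= B; rewrite /= fsub1set => kB.
rewrite /F /summability.partial_sum (bigD1 [` kB]%fset)//= eqxx conjC1 mul1r.
rewrite big1 ?addr0// => i; rewrite -val_eqE/= => /negbTE ->.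
by rewrite conjC0 mul0r.
Qed.

End Ell2.

Section CMV.
Variable R : realType.
Implicit Types (a : int -> unit_disk R) (z : R[i]) (k : int).

Definition rho a k : R[i] := sqrtC (1 - `|disk_val (a k)| ^+ 2).

Definition Theta a k : 'M[R[i]]_2 := \matrix_(i, j)
  if i == 0 then (if j == 0 then - (a k : R[i]) else rho a k)
  else (if j == 0 then rho a k else (a k : R[i])^*).

(* Action of the block diagonal operator with blocks Theta_j, for j in low,
   Theta_j acting on the coordinates j - 1 and j.  It is meant for low such
   that exactly one of k, k + 1 is in low for every k. *)
Definition block_diag a (low : pred int) (f : int -> R[i]) : int -> R[i] :=
  fun k => if low k then Theta a k 1 0 * f (k - 1) + Theta a k 1 1 * f k
           else Theta a (k + 1) 0 0 * f k + Theta a (k + 1) 0 1 * f (k + 1).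

Let normr_rho_le1 a k : `|rho a k| <= 1.
Proof.
have a1 : `|disk_val (a k)| ^+ 2 <= 1 by rewrite expr_le1// ltW// disk_lt1.
rewrite /rho ger0_norm ?sqrtC_ge0 ?subr_ge0//.
by rewrite -[X in _ <= X]sqrtC1 ler_sqrtC ?nnegrE ?subr_ge0// gerBl.
Qed.

Lemma normr_Theta_le1 a k i j : `|Theta a k i j| <= 1.
Proof.
rewrite mxE; case: ifP => _; case: ifP => _ //.
- by rewrite normrN ltW// disk_lt1.
- by rewrite norm_conjC ltW// disk_lt1.
Qed.

Lemma square_summable_block_diag a low f : f \in @square_summable R ->
  block_diag a low f \in @square_summable R.
Proof.
move=> sf.
pose c1 k := if low k then Theta a k 1 0 else 0.
pose c2 k := if low k then Theta a k 1 1 else Theta a (k + 1) 0 0.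
pose c3 k := if low k then 0 else Theta a (k + 1) 0 1.
have -> : block_diag a low f = (fun k => c1 k * f (k - 1)) +
    ((fun k => c2 k * f k) + (fun k => c3 k * f (k + 1))).
  apply/funext => k; rewrite /block_diag !fctE /c1 /c2 /c3.
  by case: ifP => _; rewrite mul0r ?addr0 ?add0r.
by rewrite !rpredD//; apply: square_summableM;
  rewrite ?square_summable_shift// => k; rewrite /c1 /c2 /c3; case: ifP => _;
  rewrite ?normr0 ?ler01 ?normr_Theta_le1.
Qed.

Definition block_op a low (f : ell2 R) : ell2 R :=
  Ell2 (square_summable_block_diag a low (ell2P f)).

Lemma block_op_is_linear a low : linear (block_op a low).
Proof.
move=> c f g; apply/val_inj/funext => k.
rewrite /= /block_diag !fctE /=.
by case: ifP => _; rewrite !scalerDr /GRing.scale/=; ring.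
Qed.

HB.instance Definition _ a low :=
  GRing.isLinear.Build R[i] (ell2 R) (ell2 R) _ (block_op a low)
    (block_op_is_linear a low).

Definition CMV_V a := block_op a evenz.
Definition CMV_W a := block_op a (predC evenz).

HB.instance Definition _ a := GRing.Linear.copy (CMV_V a) (block_op a evenz).
HB.instance Definition _ a :=
  GRing.Linear.copy (CMV_W a) (block_op a (predC evenz)).

Definition CMV a : ell2 R -> ell2 R := CMV_V a \o CMV_W a.

HB.instance Definition _ a := GRing.Linear.copy (CMV a) (CMV_V a \o CMV_W a).

Definition green a z k k' : R[i] := entry (resolvent (CMV a) z) k k'.

Definition green_g a z k : R[i] := green a z k k.

Definition green_h a z k : R[i] :=
  if evenz k then green a z k (k - 1) else green a z (k - 1) k.

Let evenz2 k : evenz (2 * k).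
Proof. by rewrite /evenz; lia. Qed.

Let evenz2D1 k : evenz (2 * k + 1) = false.
Proof. by rewrite /evenz; lia. Qed.

Let evenz2B1 k : evenz (2 * k - 1) = false.
Proof. by rewrite /evenz; lia. Qed.

Lemma CMV_V_block a k :
  [/\ entry (CMV_V a) (2 * k - 1) (2 * k - 1) = Theta a (2 * k) 0 0,
      entry (CMV_V a) (2 * k - 1) (2 * k) = Theta a (2 * k) 0 1,
      entry (CMV_V a) (2 * k) (2 * k - 1) = Theta a (2 * k) 1 0 &
      entry (CMV_V a) (2 * k) (2 * k) = Theta a (2 * k) 1 1].
Proof.
have e1 : (2 * k == 2 * k - 1) = false by lia.
have e2 : (2 * k - 1 == 2 * k) = false by lia.
split; rewrite entryE /= /block_diag ?evenz2 ?evenz2B1 ?subrK ?eqxx ?e1 ?e2;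
  by rewrite ?mulr0 ?mulr1 ?addr0 ?add0r.
Qed.

Lemma CMV_W_block a k :
  [/\ entry (CMV_W a) (2 * k) (2 * k) = Theta a (2 * k + 1) 0 0,
      entry (CMV_W a) (2 * k) (2 * k + 1) = Theta a (2 * k + 1) 0 1,
      entry (CMV_W a) (2 * k + 1) (2 * k) = Theta a (2 * k + 1) 1 0 &
      entry (CMV_W a) (2 * k + 1) (2 * k + 1) = Theta a (2 * k + 1) 1 1].
Proof.
have e1 : (2 * k == 2 * k + 1) = false by lia.
have e2 : (2 * k + 1 == 2 * k) = false by lia.
split; rewrite entryE /= /block_diag /= ?evenz2 ?evenz2D1 /= ?addrK ?eqxx ?e1 ?e2;
  by rewrite ?mulr0 ?mulr1 ?addr0 ?add0r.
Qed.

Lemma CMV_V_off_block a k k' : k' != k ->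
  k' != (if evenz k then k - 1 else k + 1) -> entry (CMV_V a) k k' = 0.
Proof.
rewrite eq_sym entryE /= /block_diag => /negbTE kk'.
by case: (evenz k); rewrite eq_sym => /negbTE ->; rewrite kk' !mulr0 addr0.
Qed.

Lemma CMV_W_off_block a k k' : k' != k ->
  k' != (if evenz k then k + 1 else k - 1) -> entry (CMV_W a) k k' = 0.
Proof.
rewrite eq_sym entryE /= /block_diag /= => /negbTE kk'.
by case: (evenz k); rewrite /= eq_sym => /negbTE ->; rewrite kk' !mulr0 addr0.
Qed.

End CMV.

(* Main.v *)
Require Import Defs.
From HB Require Import structures.
From mathcomp Require Import all_boot all_order all_algebra.
From mathcomp Require Import complex.
From mathcomp Require Import all_classical all_reals all_analysis.
From mathcomp Require Import zify ring lra.

(* For a column u of the Green's function put v = W u.  Unitarity of the blocks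
   and square summability make the homogeneous solutions on a half-lattice
   contractive at its end point, so the ratio of u to v (or of v to U u,
   depending on the parity) is the same for all of them; this defines functions
   phi_k (right half-lattice) and psi_k (left half-lattice), bounded by 1 on the
   disk.  They satisfy the Schur recursions
     phi_(k-1) = (z phi_k - conj alpha_k) / (1 - alpha_k z phi_k),
     psi_k = (z psi_(k-1) + alpha_k) / (1 + conj alpha_k z psi_(k-1)),
   so phi_k near 0 determines alpha_j for j > k, and psi_k determines alpha_j
   for j <= k.  Moreover
     g = phi_k psi_k (1 + z g),  rho_k h + conj alpha_k g = phi_k (1 + z g),
   from which the data (i) yield alpha_k (at z = 0), then phi_k and psi_k; the
   data (ii) yield the sum and the product of alpha_k z phi_k and
   conj alpha_k psi_k.  The resolvent exists by a Neumann series. *)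

Set Implicit Arguments.
Unset Strict Implicit.
Unset Printing Implicit Defensive.

Import Order.TTheory GRing.Theory Num.Theory.
Import numFieldNormedType.Exports.

Local Open Scope classical_set_scope.
Local Open Scope ring_scope.

(** * Sequences with geometrically decaying increments *)

Lemma geometric_cauchy (R : realType) (x : nat -> R) (c q : R) :
  0 <= c -> 0 < q < 1 -> (forall n, `|x n.+1 - x n| <= c * q ^+ n) ->
  exists l, forall n, `|l - x n| <= c / (1 - q) * q ^+ n.
Proof.
move=> c0 /andP[q0 q1] xP; set D := c / (1 - q).
have q1' : 0 < 1 - q by rewrite subr_gt0.
have D0 : 0 <= D by rewrite divr_ge0// ltW.
have DE : c = D * (1 - q) by rewrite /D divfK// gt_eqF.
(* Since [D * (1 - q) = c], the intervals of centre [x n] and radius [D * q ^+ n] are nested; the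
   supremum of their left ends lies in all of them. *)
have lo m n : (m <= n)%N -> x m - D * q ^+ m <= x n - D * q ^+ n.
  elim: n => [|n IH]; first by rewrite leqn0 => /eqP ->.
  rewrite leq_eqVlt => /predU1P[->//|/IH/le_trans]; apply.
  have := xP n; rewrite DE ler_norml exprS => /andP[+ _].
  by have := q ^+ n; move=> t; lra.
have hi m n : (m <= n)%N -> x n + D * q ^+ n <= x m + D * q ^+ m.
  elim: n => [|n IH]; first by rewrite leqn0 => /eqP ->.
  rewrite leq_eqVlt => /predU1P[->//|/IH]; apply: le_trans.
  have := xP n; rewrite DE ler_norml exprS => /andP[_ +].
  by have := q ^+ n; move=> t; lra.
have lohi m n : x m - D * q ^+ m <= x n + D * q ^+ n.
  have := lo _ _ (leq_maxl m n); have := hi _ _ (leq_maxr m n).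
  have : 0 <= D * q ^+ maxn m n by rewrite mulr_ge0// exprn_ge0// ltW.
  lra.
pose E : set R := range (fun n => x n - D * q ^+ n).
have supE : has_sup E.
  split; first by exists (x 0%N - D * q ^+ 0); exists 0%N.
  by exists (x 0%N + D * q ^+ 0) => _ [m _ <-].
exists (sup E) => n.
have : x n - D * q ^+ n <= sup E by apply: sup_upper_bound => //; exists n.
have : sup E <= x n + D * q ^+ n.
  by apply: ge_sup => [|_ [m _ <-]//]; case: supE.
rewrite ler_norml => *; apply/andP; split; lra.
Qed.

Lemma le_geometric (R : realType) (x b c q : R) : 0 < q < 1 ->
  (forall n : nat, x <= b + c * q ^+ n) -> x <= b.
Proof.
move=> /andP[q0 q1] xP.
have cv : (b + c * q ^+ n) @[n --> \oo] --> b + c * 0.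
  apply: cvgD; first exact: cvg_cst.
  by apply: cvgMr; apply: cvg_expr; rewrite ger0_norm// ltW.
rewrite mulr0 addr0 in cv; apply: (cvgr_to_ge cv).
by near=> n; exact: xP.
Unshelve. all: by end_near. Qed.

(** * Square sums and the block operators *)

Section ComplexSquare.
Variable R : realType.
Implicit Types x y : R[i].

Definition sqnorm x : R := Normc.normc x ^+ 2.

Lemma sqnormE x : sqnorm x = complex.Re x ^+ 2 + complex.Im x ^+ 2.
Proof.
by case: x => a b; rewrite /sqnorm /= sqr_sqrtr// addr_ge0// sqr_ge0.
Qed.

Lemma sqnorm_ge0 x : 0 <= sqnorm x. Proof. exact: sqr_ge0. Qed.

Lemma sqnormC x : (sqnorm x)%:C%C = `|x| ^+ 2.
Proof. by rewrite /sqnorm rmorphXn. Qed.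

Lemma sqnormM x y : sqnorm (x * y) = sqnorm x * sqnorm y.
Proof. by rewrite /sqnorm Normc.normcM exprMn. Qed.

Lemma sqnorm0 : sqnorm 0 = 0.
Proof. by rewrite /sqnorm Normc.normc0 expr0n. Qed.

Lemma sqnorm_eq0 x : sqnorm x = 0 -> x = 0.
Proof. by move/eqP; rewrite /sqnorm sqrf_eq0 => /eqP/Normc.eq0_normc. Qed.

(** Convexity of the squared modulus, applied to [(1 - r) * (x / (1 - r)) + r * (y / r)]. If [y]
    carries a factor of modulus at most [r], the weight [1 / r] still leaves a contraction by
    [r]. *)
Lemma sqnormD_convex (r : R) x y : 0 < r < 1 ->
  sqnorm (x + y) <= sqnorm x / (1 - r) + sqnorm y / r.
Proof.
move=> /andP[r0 r1]; rewrite !sqnormE.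
have r1' : 0 < 1 - r by rewrite subr_gt0.
have conv (s t : R) : (s + t) ^+ 2 <= s ^+ 2 / (1 - r) + t ^+ 2 / r.
  rewrite -subr_ge0.
  have -> : s ^+ 2 / (1 - r) + t ^+ 2 / r - (s + t) ^+ 2 =
      (r * s - (1 - r) * t) ^+ 2 / (r * (1 - r)).
    by field; rewrite !gt_eqF.
  by rewrite divr_ge0 ?sqr_ge0// mulr_ge0// ltW.
case: x y => [a b] [c d] /=; have := conv a c; have := conv b d.
by rewrite !mulrDl; lra.
Qed.

End ComplexSquare.

Section CMVBlocks.
Variable R : realType.
Implicit Types (a : int -> unit_disk R) (k : int) (f : int -> R[i]).

Lemma rho2 a k : rho a k ^+ 2 = 1 - (a k : R[i]) * (a k : R[i])^*.
Proof. by rewrite /rho sqrtCK normCK. Qed.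

Lemma rho_gt0 a k : 0 < rho a k.
Proof.
by rewrite /rho sqrtC_gt0 subr_gt0 expr_lt1// disk_lt1.
Qed.

Lemma rho_conj a k : (rho a k)^* = rho a k.
Proof. by apply: CrealP; rewrite ger0_real// ltW// rho_gt0. Qed.

Lemma block_diag_low a (low : pred int) f k : low k ->
  block_diag a low f k = rho a k * f (k - 1) + (a k : R[i])^* * f k.
Proof. by rewrite /block_diag !mxE /= => ->. Qed.

Lemma block_diag_high a (low : pred int) f k : low k -> ~~ low (k - 1) ->
  block_diag a low f (k - 1) = - (a k : R[i]) * f (k - 1) + rho a k * f k.
Proof. by rewrite /block_diag !mxE /= subrK => _ /negbTE ->. Qed.

(** The block [Theta a k] is unitary: the difference of the two sides is a multiple of
    [r ^+ 2 - (1 - al * ac)]. *)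
Lemma block_diag_sqnorm a (low : pred int) f k : low k -> ~~ low (k - 1) ->
  sqnorm (block_diag a low f (k - 1)) + sqnorm (block_diag a low f k) =
  sqnorm (f (k - 1)) + sqnorm (f k).
Proof.
move=> lk hk; apply: (@complexI R); rewrite !rmorphD /= !sqnormC.
rewrite (block_diag_high _ _ lk hk) (block_diag_low _ _ lk).
rewrite !normCK !rmorphD !rmorphM /= rmorphN !conjCK !rho_conj.
have := rho2 a k; set r := rho a k; set al := disk_val _; set u := f _.
set v := f k => r2; apply/subr0_eq.
set ac := al^*; set uc := u^*; set vc := v^*.
transitivity ((u * uc + v * vc) * (r ^+ 2 - (1 - al * ac))); first ring.
by rewrite r2 subrr mulr0.
Qed.

End CMVBlocks.

Section SquareSum.
Variable R : realType.
Implicit Types (a : int -> unit_disk R) (k : int) (f g : int -> R[i]).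

Definition sqsum f : \bar R := \esum_(k in [set: int]) (sqnorm (f k))%:E.

Lemma sqsum_ge0 f : (0 <= sqsum f)%E.
Proof. by apply: esum_ge0 => k _; rewrite lee_fin sqnorm_ge0. Qed.

Lemma square_summableE f : (f \in @square_summable R) = (sqsum f < +oo)%E.
Proof.
rewrite unfold_in /square_summable /summable; congr (_ < _)%E.
by apply: eq_esum => k _; rewrite gee0_abs// lee_fin sqr_ge0.
Qed.

(** [fine] turns an infinite sum into [0], so this is the squared norm only for square summable
    [f]. *)
Definition energy f : R := fine (sqsum f).

Lemma sqsumEenergy f : f \in @square_summable R -> sqsum f = (energy f)%:E.
Proof.
by rewrite square_summableE => sf; rewrite fineK// ge0_fin_numE ?sqsum_ge0.
Qed.

Lemma sum_le_energy f (s : seq int) : uniq s -> f \in @square_summable R ->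
  \sum_(k <- s) sqnorm (f k) <= energy f.
Proof.
move=> us sf; rewrite -lee_fin -sqsumEenergy// -sumEFin; apply: esum_ge.
exists [set` s]; last by rewrite -fsbig_seq.
by split => //; exact: finite_seq.
Qed.

Lemma energy_ge0 f : 0 <= energy f.
Proof. by rewrite fine_ge0 ?sqsum_ge0. Qed.

Lemma sqnorm_le_energy f k : f \in @square_summable R ->
  sqnorm (f k) <= energy f.
Proof. by move=> /(@sum_le_energy _ [:: k] isT); rewrite big_seq1. Qed.

Lemma sum_le_sqsum_le f (M : R) :
  (forall s : seq int, uniq s -> \sum_(k <- s) sqnorm (f k) <= M) ->
  (sqsum f <= M%:E)%E.
Proof.
move=> sM; apply: ge_ereal_sup => _ [X [fX _] <-].
by rewrite fsbig_finite// sumEFin lee_fin sM// finmap.fset_uniq.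
Qed.

Lemma sum_le_square_summable f (M : R) :
  (forall s : seq int, uniq s -> \sum_(k <- s) sqnorm (f k) <= M) ->
  f \in @square_summable R.
Proof.
by move=> /sum_le_sqsum_le sM; rewrite square_summableE (le_lt_trans sM)// ltry.
Qed.

Lemma sum_le_energy_le f (M : R) :
  (forall s : seq int, uniq s -> \sum_(k <- s) sqnorm (f k) <= M) ->
  energy f <= M.
Proof.
move=> sM; have := sum_le_sqsum_le sM.
by rewrite sqsumEenergy ?lee_fin//; exact: sum_le_square_summable sM.
Qed.

(** The pairs [{k - 1, k}] with [low k], on which the blocks act, tile the integers. *)
Lemma sqsum_tiling (low : pred int) f : (forall k, low (k - 1) = ~~ low k) ->
  sqsum f =
  \esum_(k in [set k | low k]) (sqnorm (f (k - 1)) + sqnorm (f k))%:E.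
Proof.
move=> tl; have n0 k : (0 <= (sqnorm (f k))%:E)%E by rewrite lee_fin sqnorm_ge0.
have -> : sqsum f = (\esum_(k in [set k | ~~ low k]) (sqnorm (f k))%:E +
    \esum_(k in [set k | low k]) (sqnorm (f k))%:E)%E.
  rewrite [X in (X + _)%E]esum_mkcond [X in (_ + X)%E]esum_mkcond -esumD.
  - apply: eq_esum => k _; rewrite !mem_setE /in_mem/=.
    by case: (low k); rewrite /= ?add0e ?adde0.
  - by move=> k _; case: ifP.
  - by move=> k _; case: ifP.
have -> : \esum_(k in [set k | ~~ low k]) (sqnorm (f k))%:E =
    \esum_(k in [set k | low k]) (sqnorm (f (k - 1)))%:E.
  apply: reindex_esum; split.
  - by move=> k /= lk; rewrite tl lk.
  - by move=> x y _ _ /addIr.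
  - move=> k /= lk; exists (k + 1); last by rewrite addrK.
    by have := tl (k + 1); rewrite addrK => lE /=; rewrite lE negbK in lk.
rewrite -esumD; last by move=> k _.
  by apply: eq_esum => k _; rewrite EFinD.
by move=> k _.
Qed.

Lemma energy_block_diag a (low : pred int) f :
  (forall k, low (k - 1) = ~~ low k) -> energy (block_diag a low f) = energy f.
Proof.
move=> tl; rewrite /energy !(sqsum_tiling _ tl); congr fine.
by apply: eq_esum => k /= lk; rewrite block_diag_sqnorm// tl lk.
Qed.

Lemma energyZ_le (z : R[i]) f : f \in @square_summable R ->
  energy (z *: f) <= sqnorm z * energy f.
Proof.
move=> sf; apply: sum_le_energy_le => s us.
under eq_bigr do rewrite sqnormM.
by rewrite -mulr_sumr ler_wpM2l ?sqnorm_ge0 ?sum_le_energy.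
Qed.

Lemma energyD_convex (r : R) f g : 0 < r < 1 ->
  f \in @square_summable R -> g \in @square_summable R ->
  energy (f + g) <= energy f / (1 - r) + energy g / r.
Proof.
move=> r01 sf sg; have /andP[r0 r1] := r01; apply: sum_le_energy_le => s us.
apply: (le_trans (ler_sum _ (fun k _ => sqnormD_convex (f k) (g k) r01))).
rewrite big_split -!mulr_suml.
by rewrite lerD// ler_wpM2r ?invr_ge0 ?subr_ge0 ?(ltW r0) ?(ltW r1)//
  sum_le_energy.
Qed.

End SquareSum.

(** * Unitarity of the CMV operator and injectivity of [CMV a - z] *)

Section Resolvent.
Variable R : realType.
Implicit Types (a : int -> unit_disk R) (k : int) (f g : ell2 R) (z : R[i]).

Lemma conj_disk_lt1 (w : unit_disk R) : `|(w : R[i])^*| < 1.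
Proof. by rewrite norm_conjC disk_lt1. Qed.

Definition conj_disk (w : unit_disk R) : unit_disk R :=
  UnitDisk (conj_disk_lt1 w).

Lemma conj_diskK : involutive conj_disk.
Proof. by move=> w; apply: val_inj; rewrite /= conjCK. Qed.

Lemma rho_conj_disk a k : rho (conj_disk \o a) k = rho a k.
Proof. by rewrite /rho /= norm_conjC. Qed.

(* The adjoint of [Theta a k] is [Theta (conj_disk \o a) k]. *)
Lemma block_opK a (low : pred int) : (forall k, low (k - 1) = ~~ low k) ->
  cancel (block_op a low) (block_op (conj_disk \o a) low).
Proof.
move=> tl f; apply/val_inj/funext => k /=.
have r2 j := rho2 a j.
have [lk|hk] := boolP (low k).
  have hk : ~~ low (k - 1) by rewrite tl lk.
  rewrite (block_diag_low _ _ lk) (block_diag_high _ _ lk hk).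
  rewrite (block_diag_low _ _ lk) rho_conj_disk /= conjCK.
  apply/subr0_eq; transitivity
    (f k * (rho a k ^+ 2 - (1 - (a k : R[i]) * (a k : R[i])^*))); first ring.
  by rewrite r2 subrr mulr0.
have lk : low (k + 1) by move: (tl (k + 1)); rewrite addrK => /esym/negbRL->.
have hk' : ~~ low (k + 1 - 1) by rewrite addrK.
rewrite -[X in block_diag _ _ _ X](addrK 1 k).
rewrite (block_diag_high _ _ lk hk') (block_diag_low _ _ lk).
rewrite (block_diag_high _ _ lk hk') addrK.
rewrite rho_conj_disk /=; apply/subr0_eq; transitivity (f k *
  (rho a (k + 1) ^+ 2 - (1 - (a (k + 1) : R[i]) * (a (k + 1) : R[i])^*))).
  by ring.
by rewrite r2 subrr mulr0.
Qed.

Lemma block_opKV a (low : pred int) : (forall k, low (k - 1) = ~~ low k) ->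
  cancel (block_op (conj_disk \o a) low) (block_op a low).
Proof.
move=> tl; have /(_ tl) := @block_opK (conj_disk \o a) low.
rewrite (_ : conj_disk \o (conj_disk \o a) = a)//.
by apply/funext => k /=; rewrite conj_diskK.
Qed.

Lemma evenz_tiling k : evenz (k - 1) = ~~ evenz k.
Proof. by rewrite /evenz; lia. Qed.

Lemma oddz_tiling k : predC evenz (k - 1) = ~~ predC evenz k.
Proof. by rewrite /= evenz_tiling. Qed.

(** The adjoint [W^* V^*] of [U = V W]. It turns [U g = f + z g] into a fixed-point equation for
    [g]. *)
Definition CMV_inv a : ell2 R -> ell2 R :=
  block_op (conj_disk \o a) (predC evenz) \o block_op (conj_disk \o a) evenz.

Lemma CMV_invKV a : cancel (CMV_inv a) (CMV a).
Proof.
move=> f; rewrite /CMV /CMV_inv /= /CMV_W block_opKV; last exact: oddz_tiling.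
by rewrite /CMV_V block_opKV//; exact: evenz_tiling.
Qed.

Lemma energy_CMV a f : energy (CMV a f) = energy f.
Proof.
rewrite /= energy_block_diag; last exact: evenz_tiling.
by rewrite energy_block_diag//; exact: oddz_tiling.
Qed.

Lemma energy_CMV_inv a f : energy (CMV_inv a f) = energy f.
Proof.
rewrite /= energy_block_diag; last exact: oddz_tiling.
by rewrite energy_block_diag//; exact: evenz_tiling.
Qed.

HB.instance Definition _ a := GRing.Linear.copy (CMV_inv a)
  (block_op (conj_disk \o a) (predC evenz) \o
   block_op (conj_disk \o a) evenz).

Lemma sqnorm_lt1 z : `|z| < 1 -> sqnorm z < 1.
Proof.
move=> z1; have : `|z| ^+ 2 < 1 by rewrite expr_lt1.
by rewrite -sqnormC ltcR.
Qed.

(** A difference [h] of two preimages satisfies [U h = z h]; as [U] preserves the energy,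
    [energy h <= |z|^2 energy h], which forces [h = 0]. *)
Lemma CMV_sub_inj a z : `|z| < 1 -> injective (fun f => CMV a f - z *: f).
Proof.
move=> /sqnorm_lt1 z1 f g /= /eqP; rewrite -subr_eq0.
have -> : CMV a f - z *: f - (CMV a g - z *: g) =
    CMV a (f - g) - z *: (f - g).
  rewrite (linearB (CMV a)) scalerBr !opprB addrACA [RHS]addrACA.
  by congr (_ + _); rewrite addrC.
rewrite subr_eq0 => /eqP ev; have := energy_CMV a (f - g).
rewrite ev => eE; have := energyZ_le z (ell2P (f - g)).
rewrite [energy _ in X in X -> _]eE => le.
have e0 : energy (f - g) <= 0.
  by have := energy_ge0 (f - g); move: (energy _) le => e; nra.
apply/eqP; rewrite -subr_eq0; apply/eqP/val_inj/funext => k.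
apply: sqnorm_eq0; apply/eqP; rewrite eq_le sqnorm_ge0 andbT.
exact: le_trans (sqnorm_le_energy k (ell2P _)) e0.
Qed.

End Resolvent.

(** * The resolvent inside the disk *)

Section Neumann.
Variable R : realType.
Implicit Types (a : int -> unit_disk R) (k : int) (f g : ell2 R) (z : R[i]).

(** The partial sums of the Neumann series of terms [z^n U^(-n-1) f], written as a fixed-point
    iteration. *)
Definition neumann a z f (n : nat) : ell2 R :=
  iter n (fun g => CMV_inv a (f + z *: g)) 0.

(** The bound reproduces itself in the induction: with [E = energy f], [E / (1 - r) + r E / (1 -
    r)^2 = E / (1 - r)^2]. *)
Lemma neumann_energy a z f (r : R) n : 0 < r < 1 -> sqnorm z <= r ^+ 2 ->
  energy (neumann a z f n) <= energy f / (1 - r) ^+ 2.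
Proof.
move=> r01 zr; have /andP[r0 r1] := r01.
have r1' : 0 < 1 - r by rewrite subr_gt0.
elim: n => [|n IH].
  apply: sum_le_energy_le => s _; rewrite big1 => [|k _]; last exact: sqnorm0.
  by rewrite divr_ge0 ?energy_ge0// exprn_ge0// ltW.
rewrite [neumann _ _ _ _]iterS energy_CMV_inv -/(neumann a z f n).
apply: (le_trans (energyD_convex r01 (ell2P f) (ell2P (z *: _)))).
have le := energyZ_le z (ell2P (neumann a z f n)).
have le' : energy (z *: neumann a z f n) <= r ^+ 2 * energy (neumann a z f n).
  by apply: (le_trans le); rewrite ler_wpM2r// energy_ge0.
have le2 : energy (z *: neumann a z f n) / r <=
    r * (energy f / (1 - r) ^+ 2).
  rewrite ler_pdivrMr// (le_trans le')//.
  rewrite [leRHS](_ : _ = r ^+ 2 * (energy f / (1 - r) ^+ 2)); last by ring.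
  by rewrite ler_wpM2l ?sqr_ge0.
apply: (le_trans (lerD (lexx _) le2)).
by rewrite le_eqVlt; apply/orP; left; apply/eqP; field; rewrite gt_eqF.
Qed.

Lemma neumann_diff a z f (r : R) n : 0 < r < 1 -> sqnorm z <= r ^+ 2 ->
  energy (neumann a z f n.+1 - neumann a z f n) <= energy f * (r ^+ n) ^+ 2.
Proof.
move=> /andP[r0 r1] zr; elim: n => [|n IH].
  rewrite /neumann /= scaler0 addr0 subr0 energy_CMV_inv.
  by rewrite expr0 expr1n mulr1.
rewrite [X in X - _]iterS [X in _ - X]iterS -!/(neumann a z f _).
rewrite -(linearB (CMV_inv a)) opprD addrACA subrr add0r -scalerBr.
rewrite energy_CMV_inv; apply: (le_trans (energyZ_le z (ell2P _))).
apply: (le_trans (ler_pM (sqnorm_ge0 _) (energy_ge0 _) zr IH)).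
by rewrite (exprS r n) exprMn mulrCA.
Qed.

Lemma Re_Im_le_sqnorm (x : R[i]) (c : R) : 0 <= c -> sqnorm x <= c ^+ 2 ->
  `|complex.Re x| <= c /\ `|complex.Im x| <= c.
Proof.
move=> c0; rewrite sqnormE => xc.
by split; rewrite -(ler_pXn2r (n := 2))// ?nnegrE// real_normK ?num_real//;
  apply: le_trans xc; rewrite ?lerDl ?lerDr sqr_ge0.
Qed.

(** The energy of an increment bounds all its coordinates at once, so real and imaginary parts
    converge with a constant independent of [k]. *)
Lemma neumann_cvg a z f (r : R) : 0 < r < 1 -> sqnorm z <= r ^+ 2 ->
  exists D : R, 0 <= D /\ exists s : int -> R[i], forall n k,
    `|s k - neumann a z f n k| <= (D * r ^+ n)%:C%C.
Proof.
move=> r01 zr; have /andP[r0 r1] := r01.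
have e0 : 0 <= energy f := energy_ge0 f.
(* Adding [1] gives [energy f <= c ^+ 2], so [c * r ^+ n] bounds the increments without a square
   root. *)
pose c := energy f + 1.
have c0 : 0 <= c by rewrite addr_ge0.
have D0 : 0 <= c / (1 - r) by rewrite divr_ge0// subr_ge0 ltW.
have cr n : 0 <= c * r ^+ n by rewrite mulr_ge0// exprn_ge0// ltW.
have dlt n k : sqnorm (neumann a z f n.+1 k - neumann a z f n k) <=
    (c * r ^+ n) ^+ 2.
  apply: (le_trans (sqnorm_le_energy k (ell2P (_ - _)))).
  apply: (le_trans (neumann_diff a f n r01 zr)).
  by rewrite exprMn ler_wpM2r ?sqr_ge0// /c; nra.
have /choice[x xP] : forall k, exists x, forall n,
    `|x - complex.Re (neumann a z f n k)| <= c / (1 - r) * r ^+ n.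
  move=> k; apply: geometric_cauchy => // n.
  by have [+ _] := Re_Im_le_sqnorm (cr n) (dlt n k); rewrite raddfB.
have /choice[y yP] : forall k, exists y, forall n,
    `|y - complex.Im (neumann a z f n k)| <= c / (1 - r) * r ^+ n.
  move=> k; apply: geometric_cauchy => // n.
  by have [_ +] := Re_Im_le_sqnorm (cr n) (dlt n k); rewrite raddfB.
exists (c / (1 - r) + c / (1 - r)); split.
  exact: addr_ge0.
exists (fun k => (x k +i* y k)%C) => n k.
have := xP k n; have := yP k n; case: (neumann a z f n k) => u v /= yv xu.
rewrite lecR -(ler_pXn2r (n := 2))// ?nnegrE ?sqrtr_ge0//; last first.
  by rewrite mulr_ge0 ?exprn_ge0 ?(ltW r0)// addr_ge0.
rewrite sqr_sqrtr ?addr_ge0 ?sqr_ge0// mulrDl [leRHS]sqrrD.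
rewrite -[(x k - u) ^+ 2]real_normK ?num_real//.
rewrite -[(y k - v) ^+ 2]real_normK ?num_real//.
move: (c / (1 - r) * r ^+ n) `|x k - u| `|y k - v| (normr_ge0 (x k - u))
  (normr_ge0 (y k - v)) xu yv => t p q p0 q0 pt qt; nra.
Qed.

Lemma CMV_sub_surj a z f : `|z| < 1 -> exists g, CMV a g - z *: g = f.
Proof.
move=> z1; have zr1 : Normc.normc z < 1 by rewrite -ltcR.
(* The midpoint of [|z|] and [1] is below [1], at least [|z|], and positive even for [z = 0]. *)
pose r := (1 + Normc.normc z) / 2.
have nz0 : 0 <= Normc.normc z by case: (z) => u v; exact: sqrtr_ge0.
have r01 : 0 < r < 1 by rewrite /r; lra.
have /andP[r0 r1] := r01.
have zr : sqnorm z <= r ^+ 2.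
  by rewrite /sqnorm lerXn2r ?nnegrE ?(ltW r0)// /r; clear z1; lra.
have [D [D0 [s sP]]] := neumann_cvg a f r01 zr.
have Dr n : 0 <= D * r ^+ n by rewrite mulr_ge0// exprn_ge0// ltW.
have sqP n k : sqnorm (s k - neumann a z f n k) <= (D * r ^+ n) ^+ 2.
  rewrite -lecR sqnormC rmorphXn lerXn2r ?nnegrE//.
  exact: le_trans (normr_ge0 _) (sP n k).
(* All iterates have energy at most [B]; comparing [s] with the iterate [n] by
   [|x + y|^2 <= 2 |x|^2 + 2 |y|^2] bounds its finite square sums by [2 * B] plus an error vanishing
   as [n] grows. *)
pose B := energy f / (1 - r) ^+ 2.
have ss : s \in @square_summable R.
  apply: (@sum_le_square_summable _ _ (2 * B)) => t ut.
  pose c := 2 * ((size t)%:R * D ^+ 2).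
  apply: (@le_geometric _ _ _ c r r01) => n.
  apply: (@le_trans _ _ (\sum_(k <- t) (2 * sqnorm (neumann a z f n k) +
      2 * (D ^+ 2 * r ^+ n)))).
    apply: ler_sum => k _.
    have h01 : 0 < (1 / 2 : R) < 1 by lra.
    have := sqnormD_convex (neumann a z f n k) (s k - neumann a z f n k) h01.
    rewrite addrC subrK => /le_trans; apply.
    have -> : 1 - 1 / 2 = 1 / 2 :> R by lra.
    rewrite div1r invrK ![_ * 2]mulrC lerD2l ler_wpM2l//.
    apply: (le_trans (sqP n k)); rewrite exprMn ler_wpM2l ?sqr_ge0//.
    by rewrite expr2 ler_piMr ?exprn_ge0 ?exprn_ile1// ltW.
  rewrite big_split -!mulr_sumr lerD//.
    rewrite ler_wpM2l//; apply: le_trans (sum_le_energy ut (ell2P _)) _.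
    exact: neumann_energy.
  rewrite big_const_seq count_predT iter_addr_0 /c.
  rewrite -[in leLHS]mulr_natl le_eqVlt; apply/orP; left; apply/eqP; ring.
pose g := Ell2 ss; exists g; apply/val_inj/funext => k.
(* Each row of a block operator has two entries of modulus at most [1], so a coordinatewise bound
   doubles under [V] and under [W], and [CMV] costs a factor [4]. *)
have blockP b low (h : int -> R[i]) (e : R) : (forall j, `|h j| <= e%:C%C) ->
    forall j, `|block_diag b low h j| <= (2 * e)%:C%C.
  move=> hP j.
  have tP i1 i2 l m : `|Theta b l i1 i2 * h m| <= e%:C%C.
    rewrite normrM; apply: le_trans (hP m).
    by rewrite ler_piMl// normr_Theta_le1.
  rewrite mulr_natl mulr2n rmorphD /block_diag; case: ifP => _;
  by rewrite (le_trans (ler_normD _ _))// lerD.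
have CMVP (h : ell2 R) (e : R) : (forall j, `|h j| <= e%:C%C) ->
    `|CMV a h k| <= (4 * e)%:C%C.
  move=> /(blockP a (predC evenz))/(blockP a evenz)/(_ k).
  by rewrite mulrA -natrM.
(* As [U] maps the iterate [n + 1] to [f] plus [z] times the iterate [n], the residual at the limit
   only involves two consecutive errors, whence the constant [4 D + D] below. *)
have eqn n : CMV a g k - z * g k - f k =
    CMV a (g - neumann a z f n.+1) k - z * (g - neumann a z f n) k.
  have -> : CMV a (g - neumann a z f n.+1) =
      CMV a g - CMV a (neumann a z f n.+1) := linearB (CMV a) _ _.
  rewrite [CMV a (neumann _ _ _ _)]CMV_invKV -/(neumann a z f n).
  change (CMV a g k - z * g k - f k = CMV a g k -
    (f k + z * neumann a z f n k) - z * (g k - neumann a z f n k)).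
  by ring.
have : (Normc.normc (CMV a g k - z * g k - f k)) <= 0.
  apply: (@le_geometric _ _ _ (5 * D) r r01) => n; rewrite add0r -lecR.
  rewrite [X in X <= _](_ : _ = `|CMV a g k - z * g k - f k|)//.
  rewrite (eqn n) (le_trans (ler_normB _ _))//.
  apply: (@le_trans _ _ ((4 * (D * r ^+ n))%:C%C + (D * r ^+ n)%:C%C)).
    apply: lerD.
      apply: CMVP => j; apply: le_trans (sP n.+1 j) _.
      by rewrite lecR ler_wpM2l// exprS ler_piMl ?exprn_ge0// ltW.
    rewrite normrM; apply: le_trans (sP n k).
    by rewrite ler_piMl// ltW.
  rewrite -rmorphD lecR; lra.
move=> le0; apply/eqP; rewrite -subr_eq0 -normr_eq0 eq_le normr_ge0 andbT.
by rewrite -lecR in le0.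
Qed.

(** Surjectivity yields a right inverse and injectivity makes it two-sided, so [get] in [resolvent]
    selects a genuine inverse and not its default. *)
Lemma resolventP a z : `|z| < 1 ->
  forall f, CMV a (resolvent (CMV a) z f) = z *: resolvent (CMV a) z f + f.
Proof.
move=> z1 f; have /choice[B BP] := fun f => CMV_sub_surj a f z1.
have B2 : [set B0 : ell2 R -> ell2 R | cancel B0 (fun f => CMV a f - z *: f) /\
    cancel (fun f => CMV a f - z *: f) B0] B.
  by split => // g; apply: (CMV_sub_inj z1); exact: BP.
have [+ _] := getPex (ex_intro _ B B2).
by move=> /(_ f) eqf; rewrite -[X in _ + X]eqf addrC subrK.
Qed.

End Neumann.

(** * Half-lattice solutions *)

Section WeylSolutions.
Variable R : realType.
Implicit Types (a : int -> unit_disk R) (k : int) (u : ell2 R) (z : R[i]).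

Lemma CMV_W_odd a u k : ~~ evenz k ->
  CMV_W a u (k - 1) = - (a k : R[i]) * u (k - 1) + rho a k * u k /\
  CMV_W a u k = rho a k * u (k - 1) + (a k : R[i])^* * u k.
Proof.
move=> ok; split; last exact: block_diag_low.
by apply: block_diag_high; rewrite //= evenz_tiling ok.
Qed.

Lemma CMV_even a u k : evenz k ->
  CMV a u (k - 1) = - (a k : R[i]) * CMV_W a u (k - 1) + rho a k * CMV_W a u k
  /\
  CMV a u k = rho a k * CMV_W a u (k - 1) + (a k : R[i])^* * CMV_W a u k.
Proof.
move=> ek; split; last exact: block_diag_low.
by apply: block_diag_high; rewrite // evenz_tiling ek.
Qed.

Lemma CMV_W_sqnorm a u k : ~~ evenz k ->
  sqnorm (CMV_W a u (k - 1)) + sqnorm (CMV_W a u k) =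
  sqnorm (u (k - 1)) + sqnorm (u k).
Proof.
by move=> ok; apply: block_diag_sqnorm; rewrite //= evenz_tiling ok.
Qed.

Lemma CMV_sqnorm a u k : evenz k ->
  sqnorm (CMV a u (k - 1)) + sqnorm (CMV a u k) =
  sqnorm (CMV_W a u (k - 1)) + sqnorm (CMV_W a u k).
Proof.
by move=> ek; apply: block_diag_sqnorm; rewrite // evenz_tiling ek.
Qed.

(** The inequality is strict so that the Green's function column with source at [k] solves on both
    sides of [k]. *)
Definition right_solution a z k u :=
  forall i, k < i -> CMV a u i = z * u i.

Definition left_solution a z k u :=
  forall i, i < k -> CMV a u i = z * u i.

(** Two consecutive relations give [A 0 - B 0 = B 1 - A 1 <= A 2 - B 2], and so on along the even
    indices. *)
Lemma alternating_telescope (A B : nat -> R) : (forall n, 0 <= B n) ->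
  (forall n, B n.*2 + B n.*2.+1 = A n.*2 + A n.*2.+1) ->
  (forall n, B n.*2.+1 + B n.*2.+2 <= A n.*2.+1 + A n.*2.+2) ->
  forall n, A 0%N - B 0%N <= A n.*2.
Proof.
move=> B0 eqAB leAB n; suff : A 0%N - B 0%N <= A n.*2 - B n.*2.
  by have := B0 n.*2; lra.
elim: n => [//|n IH]; rewrite doubleS.
by have := eqAB n; have := leAB n; lra.
Qed.

Lemma le_square_summable_seq u (e : nat -> int) (x : R) : injective e ->
  (forall n, x <= sqnorm (u (e n))) -> x <= 0.
Proof.
move=> inj_e xP; rewrite leNgt; apply/negP => x0.
pose n := (Num.truncn (energy u / x)).+1.
have := @sum_le_energy _ u (map e (iota 0 n)).
rewrite map_inj_uniq// iota_uniq => /(_ isT (ell2P u)).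
rewrite big_map leNgt => /negP; apply.
apply: (@lt_le_trans _ _ (\sum_(i <- iota 0 n) x)); last exact: ler_sum.
rewrite big_const_seq count_predT size_iota iter_addr_0 -mulr_natl.
by rewrite -ltr_pdivrMr// truncnS_gt.
Qed.

Lemma sqnorm_le a z u i : `|z| < 1 -> CMV a u i = z * u i ->
  sqnorm (CMV a u i) <= sqnorm (u i).
Proof.
by move=> /sqnorm_lt1 z1 ->; rewrite sqnormM ler_piMl ?sqnorm_ge0// ltW.
Qed.

Lemma ler_norm_sqnorm (x y : R[i]) : (`|x| <= `|y|) = (sqnorm x <= sqnorm y).
Proof. by rewrite -[RHS]lecR !sqnormC ler_pXn2r// nnegrE. Qed.

(** With [k] even, [W] preserves the square sums over the pairs [k + 2n, k + 2n + 1], while [V] and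
    [U u = z u] do not increase those over the next pairs. Telescoping bounds
    [|u k|^2 - |(W u) k|^2] by [|u (k + 2n)|^2] for every [n], and square summability makes it
    nonpositive. *)
Lemma right_contraction a z k u : `|z| < 1 -> evenz k ->
  right_solution a z k u -> `|u k| <= `|CMV_W a u k|.
Proof.
move=> z1 ek rs; rewrite ler_norm_sqnorm -subr_le0.
apply: (@le_square_summable_seq u (fun n => k + n.*2%:Z)).
  by move=> m n /= e; lia.
pose A (n : nat) := sqnorm (u (k + n%:Z)).
pose B (n : nat) := sqnorm (CMV_W a u (k + n%:Z)).
move=> n; have := @alternating_telescope A B; rewrite /A /B addr0; apply.
- by move=> m; exact: sqnorm_ge0.
- move=> m; have -> : k + m.*2%:Z = k + m.*2.+1%:Z - 1 by lia.
  by rewrite CMV_W_sqnorm//; move: ek; rewrite /evenz; lia.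
- move=> m; have -> : k + m.*2.+1%:Z = k + m.*2.+2%:Z - 1 by lia.
  rewrite -CMV_sqnorm; last by move: ek; rewrite /evenz; lia.
  by apply: lerD; apply: (sqnorm_le z1); apply: rs; lia.
Qed.

(** Mirror image: for odd [k] the pair [k - 1, k] is a block of [W], and the telescoping runs to the
    left. *)
Lemma left_contraction a z k u : `|z| < 1 -> ~~ evenz k ->
  left_solution a z k u -> `|u k| <= `|CMV_W a u k|.
Proof.
move=> z1 ok ls; rewrite ler_norm_sqnorm -subr_le0.
apply: (@le_square_summable_seq u (fun n => k - n.*2%:Z)).
  by move=> m n /= e; lia.
pose A (n : nat) := sqnorm (u (k - n%:Z)).
pose B (n : nat) := sqnorm (CMV_W a u (k - n%:Z)).
move=> n; have := @alternating_telescope A B; rewrite /A /B subr0; apply.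
- by move=> m; exact: sqnorm_ge0.
- move=> m; have -> : k - m.*2.+1%:Z = k - m.*2%:Z - 1 by lia.
  rewrite addrC CMV_W_sqnorm; first by rewrite addrC.
  by move: ok; rewrite /evenz; lia.
- move=> m; have -> : k - m.*2.+2%:Z = k - m.*2.+1%:Z - 1 by lia.
  rewrite addrC -CMV_sqnorm; last by move: ok; rewrite /evenz; lia.
  by rewrite addrC; apply: lerD; apply: (sqnorm_le z1); apply: ls; lia.
Qed.

Lemma CMV_W_comb a (c d : R[i]) u u' k : CMV_W a (c *: u - d *: u') k =
  c * CMV_W a u k - d * CMV_W a u' k.
Proof. by rewrite (linearB (CMV_W a)) !(linearZ_LR (CMV_W a)). Qed.

Lemma CMV_comb a (c d : R[i]) u u' k : CMV a (c *: u - d *: u') k =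
  c * CMV a u k - d * CMV a u' k.
Proof. by rewrite (linearB (CMV a)) !(linearZ_LR (CMV a)). Qed.

Lemma right_solutionB a z k (c d : R[i]) u u' : right_solution a z k u ->
  right_solution a z k u' -> right_solution a z k (c *: u - d *: u').
Proof.
by move=> ru ru' i ki; rewrite CMV_comb ru// ru'// mulrBr ![z * (_ * _)]mulrCA.
Qed.

Lemma left_solutionB a z k (c d : R[i]) u u' : left_solution a z k u ->
  left_solution a z k u' -> left_solution a z k (c *: u - d *: u').
Proof.
by move=> lu lu' i ki; rewrite CMV_comb lu// lu'// mulrBr ![z * (_ * _)]mulrCA.
Qed.

(* The combination of two solutions which kills [CMV_W a _ k] also vanishes
   at [k], by contraction. *)
Lemma right_proportional a z k u u' : `|z| < 1 -> evenz k ->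
  right_solution a z k u -> right_solution a z k u' ->
  CMV_W a u' k * u k = CMV_W a u k * u' k.
Proof.
move=> z1 ek ru ru'; apply/subr0_eq.
have := right_contraction z1 ek (right_solutionB (CMV_W a u' k)
  (CMV_W a u k) ru ru').
by rewrite CMV_W_comb mulrC subrr normr0 normr_le0 => /eqP.
Qed.

Lemma left_proportional a z k u u' : `|z| < 1 -> ~~ evenz k ->
  left_solution a z k u -> left_solution a z k u' ->
  CMV_W a u' k * u k = CMV_W a u k * u' k.
Proof.
move=> z1 ek ru ru'; apply/subr0_eq.
have := left_contraction z1 ek (left_solutionB (CMV_W a u' k)
  (CMV_W a u k) ru ru').
by rewrite CMV_W_comb mulrC subrr normr0 normr_le0 => /eqP.
Qed.

Definition green_column a z k : ell2 R := resolvent (CMV a) z (delta R k).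

Lemma greenE a z k k' : green a z k k' = green_column a z k' k.
Proof. by rewrite /green entryE. Qed.

Lemma CMV_green_column a z k i : `|z| < 1 ->
  CMV a (green_column a z k) i = z * green_column a z k i + (i == k)%:R.
Proof. by move=> z1; rewrite /green_column resolventP. Qed.

Lemma right_green_column a z k k' : `|z| < 1 -> k' <= k ->
  right_solution a z k (green_column a z k').
Proof.
move=> z1 kk' i ki; rewrite CMV_green_column// (_ : i == k' = false) ?addr0//.
lia.
Qed.

Lemma left_green_column a z k k' : `|z| < 1 -> k <= k' ->
  left_solution a z k (green_column a z k').
Proof.
move=> z1 kk' i ki; rewrite CMV_green_column// (_ : i == k' = false) ?addr0//.
lia.
Qed.

(** If [(W u) k] vanished, so would [u k] by contraction, then [(W u) (k - 1)] by the equation at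
    [k], then [u (k - 1)] by left contraction; the equation at the source [k - 1] would read
    [0 = 1]. *)
Lemma green_column_right_neq0 a z k : `|z| < 1 -> evenz k ->
  CMV_W a (green_column a z (k - 1)) k != 0.
Proof.
move=> z1 ek; set u := green_column _ _ _; apply/eqP => v0.
have ru : right_solution a z k u by apply: right_green_column => //; lia.
have lu : left_solution a z (k - 1) u by apply: left_green_column => //; lia.
have u0 : u k = 0.
  apply/eqP; rewrite -normr_le0 -(normr0 R[i]) -v0.
  exact: (right_contraction z1 _ ru).
have ok : ~~ evenz (k - 1) by rewrite evenz_tiling ek.
have [] := CMV_even a u ek; rewrite !CMV_green_column// -/u.
rewrite v0 u0 !mulr0 !addr0 eqxx (_ : k == k - 1 = false); last by lia.
rewrite add0r => e1 /esym/eqP; rewrite mulf_eq0 gt_eqF ?rho_gt0// orFb.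
move=> /eqP w0.
have uk1 : u (k - 1) = 0.
  apply/eqP; rewrite -normr_le0 -(normr0 R[i]) -w0.
  exact: (left_contraction z1 _ lu).
by move: e1; rewrite w0 uk1 !mulr0 add0r => /eqP; rewrite oner_eq0.
Qed.

Lemma green_column_left_neq0 a z k : `|z| < 1 -> ~~ evenz k ->
  CMV_W a (green_column a z (k + 1)) k != 0.
Proof.
move=> z1 ok; set u := green_column _ _ _; apply/eqP => v0.
have ru : right_solution a z (k + 1) u by apply: right_green_column => //; lia.
have lu : left_solution a z k u by apply: left_green_column => //; lia.
have u0 : u k = 0.
  apply/eqP; rewrite -normr_le0 -(normr0 R[i]) -v0.
  exact: (left_contraction z1 _ lu).
have ek : evenz (k + 1) by move: ok; rewrite /evenz; lia.
have [] := CMV_even a u ek; rewrite !CMV_green_column// -/u addrK.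
rewrite v0 u0 !mulr0 add0r eqxx (_ : k == k + 1 = false); last by lia.
move=> /esym/eqP; rewrite !add0r mulf_eq0 gt_eqF ?rho_gt0// orFb => /eqP w0.
have uk1 : u (k + 1) = 0.
  apply/eqP; rewrite -normr_le0 -(normr0 R[i]) -w0.
  exact: (right_contraction z1 _ ru).
by rewrite w0 uk1 !mulr0 add0r => /eqP; rewrite oner_eq0.
Qed.

End WeylSolutions.

(** * Schur functions *)

Section SchurFunctions.
Variable R : realType.
Implicit Types (a : int -> unit_disk R) (k : int) (u : ell2 R) (z w : R[i]).

(** Meant for even [k]: the source [k - 1] makes the column a right solution at [k] with nonzero
    denominator. *)
Definition right_ratio a z k : R[i] :=
  let u := green_column a z (k - 1) in u k / CMV_W a u k.

Definition left_ratio a z k : R[i] :=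
  let u := green_column a z (k + 1) in u k / CMV_W a u k.

(** This is [phi_k]. For odd [k] the Schur recursion is imposed by definition; [right_solution_odd]
    then identifies the value as the ratio of [W u] to [U u]. *)
Definition schur_right a z k : R[i] :=
  if evenz k then right_ratio a z k
  else let w := z * right_ratio a z (k + 1) in
    (w - (a (k + 1) : R[i])^*) / (1 - (a (k + 1) : R[i]) * w).

(** This is [psi_k], with the roles of the parities exchanged. *)
Definition schur_left a z k : R[i] :=
  if evenz k then let w := z * left_ratio a z (k - 1) in
    (w + (a k : R[i])) / (1 + (a k : R[i])^* * w)
  else left_ratio a z k.

Lemma one_sub_neq0 (x y : R[i]) : `|x| < 1 -> `|y| <= 1 -> 1 - x * y != 0.
Proof.
move=> x1 y1; rewrite subr_eq0; apply/eqP => e.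
have : `|x * y| < 1 by rewrite normrM (le_lt_trans _ x1)// ler_piMr.
by rewrite -e normr1 ltxx.
Qed.

Lemma one_sub_disk_neq0 (b : unit_disk R) w : `|w| <= 1 ->
  1 - (b : R[i]) * w != 0.
Proof. exact/one_sub_neq0/disk_lt1. Qed.

Lemma one_add_disk_neq0 (b : unit_disk R) w : `|w| <= 1 ->
  1 + (b : R[i])^* * w != 0.
Proof.
rewrite -[_ * w]opprK -mulrN => w1.
by apply: one_sub_neq0; rewrite ?norm_conjC ?disk_lt1// normrN.
Qed.

(** From [|1 - b w|^2 - |w - b^*|^2 = (1 - |b|^2) (1 - |w|^2)]. *)
Lemma mobius_le1 (b : R[i]) w : `|b| < 1 -> `|w| <= 1 ->
  `|(w - b^*) / (1 - b * w)| <= 1.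
Proof.
move=> b1 w1; have D0 := one_sub_neq0 b1 w1.
rewrite normf_div ler_pdivrMr ?normr_gt0// mul1r.
rewrite -(ler_pXn2r (n := 2))// ?nnegrE//.
have bw : 0 <= (1 - b * b^*) * (1 - w * w^*).
  by rewrite -!normCK mulr_ge0// subr_ge0 expr_le1// ltW.
rewrite -subr_ge0 (le_trans bw)// le_eqVlt; apply/orP; left; apply/eqP.
by rewrite !normCK !rmorphB !rmorphM rmorph1 /= conjCK; ring.
Qed.

Lemma normM_le1 z w : `|z| < 1 -> `|w| <= 1 -> `|z * w| <= 1.
Proof. by move=> z1 w1; rewrite normrM mulr_ile1// ltW. Qed.

Lemma right_ratio_le1 a z k : `|z| < 1 -> evenz k -> `|right_ratio a z k| <= 1.
Proof.
move=> z1 ek; rewrite normf_div ler_pdivrMr ?normr_gt0 ?mul1r; last first.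
  exact: green_column_right_neq0.
by apply: (right_contraction z1 ek); apply: right_green_column => //; lia.
Qed.

Lemma left_ratio_le1 a z k : `|z| < 1 -> ~~ evenz k -> `|left_ratio a z k| <= 1.
Proof.
move=> z1 ok; rewrite normf_div ler_pdivrMr ?normr_gt0 ?mul1r; last first.
  exact: green_column_left_neq0.
by apply: (left_contraction z1 ok); apply: left_green_column => //; lia.
Qed.

Lemma evenzD1 k : evenz (k + 1) = ~~ evenz k.
Proof. by rewrite -[in RHS](addrK 1 k) evenz_tiling negbK. Qed.

Lemma schur_right_even a z k : evenz k -> schur_right a z k = right_ratio a z k.
Proof. by rewrite /schur_right => ->. Qed.

Lemma schur_right_odd a z k : ~~ evenz k ->
  schur_right a z k = (z * schur_right a z (k + 1) - (a (k + 1) : R[i])^*) /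
    (1 - (a (k + 1) : R[i]) * (z * schur_right a z (k + 1))).
Proof. by rewrite /schur_right evenzD1 => /negbTE ->. Qed.

Lemma schur_left_odd a z k : ~~ evenz k -> schur_left a z k = left_ratio a z k.
Proof. by rewrite /schur_left => /negbTE ->. Qed.

Lemma schur_left_even a z k : evenz k ->
  schur_left a z k = (z * schur_left a z (k - 1) + (a k : R[i])) /
    (1 + (a k : R[i])^* * (z * schur_left a z (k - 1))).
Proof. by rewrite /schur_left evenz_tiling => ->. Qed.

Lemma schur_right_le1 a z k : `|z| < 1 -> `|schur_right a z k| <= 1.
Proof.
move=> z1; have [ek|ok] := boolP (evenz k).
  by rewrite schur_right_even ?right_ratio_le1.
rewrite schur_right_odd// mobius_le1 ?disk_lt1// normM_le1//.
by rewrite schur_right_even ?right_ratio_le1// evenzD1.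
Qed.

Lemma schur_left_le1 a z k : `|z| < 1 -> `|schur_left a z k| <= 1.
Proof.
move=> z1; have [ek|ok] := boolP (evenz k); last first.
  by rewrite schur_left_odd ?left_ratio_le1.
rewrite schur_left_even//; set w := z * _.
have -> : w + (a k : R[i]) = w - (- (a k : R[i])^*)^*.
  by rewrite rmorphN /= conjCK opprK.
rewrite -[_^* * w]opprK -mulNr mobius_le1 ?normrN ?norm_conjC ?disk_lt1//.
by rewrite normM_le1// schur_left_odd ?left_ratio_le1// evenz_tiling ek.
Qed.

Lemma right_solution_even a z k u : `|z| < 1 -> evenz k ->
  right_solution a z k u -> u k = schur_right a z k * CMV_W a u k.
Proof.
move=> z1 ek ru; have v0 := green_column_right_neq0 a z1 ek.
apply: (mulfI v0); rewrite schur_right_even// mulrA.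
rewrite [_ * right_ratio _ _ _]mulrC.
rewrite /right_ratio divfK// [RHS]mulrC; apply: (right_proportional z1 ek ru).
by apply: right_green_column => //; lia.
Qed.

Lemma left_solution_odd a z k u : `|z| < 1 -> ~~ evenz k ->
  left_solution a z k u -> u k = schur_left a z k * CMV_W a u k.
Proof.
move=> z1 ok lu; have v0 := green_column_left_neq0 a z1 ok.
apply: (mulfI v0); rewrite schur_left_odd// mulrA [_ * left_ratio _ _ _]mulrC.
rewrite /left_ratio divfK// [RHS]mulrC; apply: (left_proportional z1 ok lu).
by apply: left_green_column => //; lia.
Qed.

(** Eliminate [(W u) (k + 1)] from the two rows of the block of [V] on [k, k + 1], where [u (k + 1)]
    is known through [phi_(k+1)]. *)
Lemma right_solution_odd a z k u : `|z| < 1 -> ~~ evenz k ->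
  right_solution a z k u ->
  CMV_W a u k = schur_right a z k * CMV a u k.
Proof.
move=> z1 ok ru; have ek : evenz (k + 1) by rewrite evenzD1.
have ru1 : right_solution a z (k + 1) u by move=> i ki; apply: ru; lia.
have phi1 := normM_le1 z1 (schur_right_le1 a (k + 1) z1).
have D0 := one_sub_disk_neq0 (a (k + 1)) phi1.
have [] := CMV_even a u ek; rewrite (ru (k + 1)); last by lia.
rewrite (right_solution_even z1 ek ru1) mulrA addrK => -> e1.
rewrite schur_right_odd//; move: e1 D0 (rho2 a (k + 1)).
have := gt_eqF (rho_gt0 a (k + 1)); set r := rho _ _ => r0.
move: (CMV_W a u k) (CMV_W a u (k + 1)) (z * _) => vk vj w e1 D0 r2.
set al := disk_val _; set ac := al^*.
rewrite -/al -/ac in e1 D0 r2.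
apply: (mulfI (negbT r0)); apply: (mulfI D0); apply/subr0_eq.
transitivity (- r ^+ 2 * (w * vj - (r * vk + ac * vj)) -
  r * vk * (r ^+ 2 - (1 - al * ac))); first by field.
by rewrite e1 r2 !subrr !mulr0 subrr.
Qed.

Lemma left_solution_even a z k u : `|z| < 1 -> evenz k ->
  left_solution a z k u ->
  CMV_W a u k = schur_left a z k * CMV a u k.
Proof.
move=> z1 ek lu; have ok : ~~ evenz (k - 1) by rewrite evenz_tiling ek.
have lu1 : left_solution a z (k - 1) u by move=> i ki; apply: lu; lia.
have psi1 := normM_le1 z1 (schur_left_le1 a (k - 1) z1).
have D0 := one_add_disk_neq0 (a k) psi1.
have [] := CMV_even a u ek; rewrite (lu (k - 1)); last by lia.
rewrite (left_solution_odd z1 ok lu1) mulrA => e1 ->.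
rewrite schur_left_even//; move: e1 D0 (rho2 a k).
have := gt_eqF (rho_gt0 a k); set r := rho _ _ => r0.
move: (CMV_W a u k) (CMV_W a u (k - 1)) (z * _) => vk vj w e1 D0 r2.
set al := disk_val _; set ac := al^*.
rewrite -/al -/ac in e1 D0 r2.
apply: (mulfI (negbT r0)); apply: (mulfI D0); apply/subr0_eq.
transitivity (- (w * vj - (- al * vj + r * vk)) * (1 + ac * w - ac * (w + al)) -
  vj * (w + al) * (r ^+ 2 - (1 - al * ac))); first by field.
by rewrite e1 r2 !subrr oppr0 mul0r mulr0 subrr.
Qed.

Lemma schur_right_rec a z k : `|z| < 1 ->
  schur_right a z (k - 1) * (1 - (a k : R[i]) * (z * schur_right a z k)) =
  z * schur_right a z k - (a k : R[i])^*.
Proof.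
move=> z1; have phi1 := normM_le1 z1 (schur_right_le1 a k z1).
have [ek|ok] := boolP (evenz k).
  have ok : ~~ evenz (k - 1) by rewrite evenz_tiling ek.
  by rewrite schur_right_odd// subrK divfK// one_sub_disk_neq0.
have ek : evenz (k - 1) by rewrite evenz_tiling.
(* For odd [k] the recursion is read off the block of [W] on [k - 1, k], using a solution with
   [(W u) (k - 1)] nonzero. *)
pose u := green_column a z (k - 1 - 1).
have ru : right_solution a z (k - 1) u by apply: right_green_column => //; lia.
have ru1 : right_solution a z k u by move=> i ki; apply: ru; lia.
have := green_column_right_neq0 a z1 ek; rewrite -/u.
have := right_solution_even z1 ek ru; have := right_solution_odd z1 ok ru1.
rewrite (ru k); last by lia.
have [-> ->] := CMV_W_odd a u ok; move: (rho2 a k) (rho_gt0 a k) => r2 rgt.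
have := gt_eqF rgt; move: {rgt} (rho a k) r2 => r r2 r0.
rewrite [schur_right a z k * (z * _)]mulrCA [z * (schur_right a z k * _)]mulrA.
move: (z * schur_right a z k) => w.
move: (schur_right a z (k - 1)) (u (k - 1)) (u k) => p uj uk.
set al := disk_val _; set ac := al^*; rewrite -/al -/ac in r2.
move=> e1 e2 v0.
have uk0 : uk != 0.
  apply: contra_neq v0 => uk0; rewrite uk0 !mulr0 !addr0 in e1 *.
  by move/eqP: e1; rewrite mulf_eq0 r0 orFb => /eqP ->; rewrite mulr0.
apply: (mulfI uk0); apply/subr0_eq.
transitivity ((p * al + 1) * (r * uj + ac * uk - w * uk) -
  r * (uj - p * (- al * uj + r * uk)) -
  p * uk * (r ^+ 2 - (1 - al * ac))); first by ring.
by rewrite e1 -e2 r2 !subrr !mulr0 !subrr.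
Qed.

Lemma schur_left_rec a z k : `|z| < 1 ->
  schur_left a z k * (1 + (a k : R[i])^* * (z * schur_left a z (k - 1))) =
  z * schur_left a z (k - 1) + (a k : R[i]).
Proof.
move=> z1; have psi1 := normM_le1 z1 (schur_left_le1 a (k - 1) z1).
have [ek|ok] := boolP (evenz k).
  by rewrite schur_left_even// divfK// one_add_disk_neq0.
have ek : evenz (k - 1) by rewrite evenz_tiling.
(* As on the right, a test solution for the block of [W] on [k - 1, k], now with [(W u) k]
   nonzero. *)
pose u := green_column a z (k + 1).
have lu : left_solution a z k u by apply: left_green_column => //; lia.
have lu1 : left_solution a z (k - 1) u by move=> i ki; apply: lu; lia.
have := green_column_left_neq0 a z1 ok; rewrite -/u.
have := left_solution_odd z1 ok lu; have := left_solution_even z1 ek lu1.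
rewrite (lu (k - 1)); last by lia.
have [-> ->] := CMV_W_odd a u ok; move: (rho2 a k) (rho_gt0 a k) => r2 rgt.
have := gt_eqF rgt; move: {rgt} (rho a k) r2 => r r2 r0.
rewrite [schur_left a z (k - 1) * (z * _)]mulrCA.
rewrite [z * (schur_left a z (k - 1) * _)]mulrA.
move: (z * schur_left a z (k - 1)) => w.
move: (schur_left a z k) (u (k - 1)) (u k) => p uj uk.
set al := disk_val _; set ac := al^*; rewrite -/al -/ac in r2.
move=> e1 e2 v0.
have uj0 : uj != 0.
  apply: contra_neq v0 => uj0; rewrite uj0 !mulr0 !add0r in e1 *.
  by move/eqP: e1; rewrite mulf_eq0 r0 orFb => /eqP ->; rewrite mulr0.
apply: (mulfI uj0); apply/subr0_eq.
transitivity ((1 - p * ac) * (- al * uj + r * uk - w * uj) -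
  r * (uk - p * (r * uj + ac * uk)) -
  p * uj * (r ^+ 2 - (1 - al * ac))); first by ring.
by rewrite e1 -e2 r2 !subrr !mulr0 !subrr.
Qed.

(** The column [k] is both a right and a left solution at [k]: [phi_k] and [psi_k] link [u k] to
    [(W u) k] and [(W u) k] to [(U u) k], in an order set by the parity, and [(U u) k = 1 + z g]. *)
Lemma green_g_schur a z k : `|z| < 1 -> green_g a z k =
  schur_right a z k * schur_left a z k * (1 + z * green_g a z k).
Proof.
move=> z1; rewrite /green_g greenE.
have ru : right_solution a z k (green_column a z k).
  by apply: right_green_column.
have lu : left_solution a z k (green_column a z k).
  by apply: left_green_column.
have eC := CMV_green_column a k k z1; rewrite eqxx addrC in eC.
have [ek|ok] := boolP (evenz k).
  rewrite {1}(right_solution_even z1 ek ru) (left_solution_even z1 ek lu) eC.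
  by rewrite mulrA.
rewrite {1}(left_solution_odd z1 ok lu) (right_solution_odd z1 ok ru) eC.
by rewrite mulrA [_ * schur_left _ _ _]mulrC.
Qed.

Lemma one_add_green_g_neq0 a z k : `|z| < 1 -> 1 + z * green_g a z k != 0.
Proof.
move=> z1; apply/eqP => e; have := green_g_schur a k z1; rewrite e mulr0 => g0.
by move/eqP: e; rewrite g0 mulr0 addr0 oner_eq0.
Qed.

Lemma green_h_schur a z k : `|z| < 1 ->
  rho a k * green_h a z k + (a k : R[i])^* * green_g a z k =
  schur_right a z k * (1 + z * green_g a z k).
Proof.
move=> z1; have := green_g_schur a k z1; have := one_add_green_g_neq0 a k z1.
rewrite /green_h; have [ek|ok] := boolP (evenz k); last first.
  rewrite /green_g !greenE => _ _.
  have ru : right_solution a z k (green_column a z k).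
    exact: right_green_column.
  have := right_solution_odd z1 ok ru.
  have [_ ->] := CMV_W_odd a (green_column a z k) ok => ->.
  by rewrite CMV_green_column// eqxx addrC.
(* For even [k], [h] lies in the column [k - 1], a right solution at [k] and a left solution at
   [k - 1]; the block of [V] on [k - 1, k] joins the two halves, and the formula for [g] eliminates
   the denominator. *)
rewrite greenE; move: (green_g a z k) => g.
have ok : ~~ evenz (k - 1) by rewrite evenz_tiling ek.
pose u := green_column a z (k - 1); rewrite -/u.
have ru : right_solution a z k u by apply: right_green_column => //; lia.
have lu : left_solution a z (k - 1) u by exact: left_green_column.
have D0 := one_add_disk_neq0 (a k) (normM_le1 z1 (schur_left_le1 a (k - 1) z1)).
have [] := CMV_even a u ek; rewrite !CMV_green_column// eqxx -/u.
rewrite (_ : k == k - 1 = false) ?addr0; last by lia.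
have := schur_left_rec a k z1.
rewrite (right_solution_even z1 ek ru) (left_solution_odd z1 ok lu).
move: (CMV_W a u k) (CMV_W a u (k - 1)) (schur_right a z k) (schur_left a z k)
  (schur_left a z (k - 1)) (rho a k) (rho2 a k) D0 => v v' p q q' r r2 D0.
set al := disk_val _; set ac := al^*; rewrite -/al -/ac in r2 D0.
move=> recq e1 e2 _ eg.
have vD : v * (1 + ac * (z * q')) * (1 - z * p * q) = r.
  apply/subr0_eq; transitivity
    (- z * p * v * (q * (1 + ac * (z * q')) - (z * q' + al)) -
     (z * q' + al) * (z * (p * v) - (r * v' + ac * v)) -
     r * (z * (q' * v') + 1 - (- al * v' + r * v)) -
     v * (r ^+ 2 - (1 - al * ac))); first by ring.
  by rewrite recq e1 e2 r2 !subrr !mulr0 !subrr.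
have pq : (1 + z * g) * (1 - z * p * q) = 1.
  apply/subr0_eq; transitivity (z * (g - p * q * (1 + z * g))); first by ring.
  by rewrite -eg subrr mulr0.
have vE : v * (1 + ac * (z * q')) = r * (1 + z * g).
  by rewrite -[LHS]mulr1 -[X in _ * X = _]pq -[in RHS]vD; ring.
apply: (mulIf D0); apply/subr0_eq; transitivity
  (r * p * (v * (1 + ac * (z * q')) - r * (1 + z * g)) +
   ac * (1 + ac * (z * q')) * (g - p * q * (1 + z * g)) +
   ac * p * (1 + z * g) * (q * (1 + ac * (z * q')) - (z * q' + al)) +
   p * (1 + z * g) * (r ^+ 2 - (1 - al * ac))); first by ring.
by rewrite recq vE -eg r2 !subrr !mulr0 !addr0.
Qed.

End SchurFunctions.

(** * Recovering the Verblunsky coefficients *)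

Section SchurAlgorithm.
Variable R : realType.
Implicit Types (a : int -> unit_disk R) (k : int) (z : R[i]).

(** The recursion rearranges to [phi_k + conj alpha_(k+1) = z phi_(k+1) (1 + alpha_(k+1) phi_k)],
    whose last factor has modulus at most [2]. *)
Lemma schur_right_bound a z k : `|z| < 1 ->
  `|schur_right a z k + (a (k + 1) : R[i])^*| <= 2 * `|z|.
Proof.
move=> z1; have := schur_right_rec a (k + 1) z1; rewrite addrK => rec.
have -> : schur_right a z k + (a (k + 1) : R[i])^* =
    z * schur_right a z (k + 1) * (1 + (a (k + 1) : R[i]) * schur_right a z k).
  apply/subr0_eq; move: rec; set al := disk_val _; set ac := al^* => rec.
  transitivity (schur_right a z k * (1 - al * (z * schur_right a z (k + 1))) -
    (z * schur_right a z (k + 1) - ac)); first by ring.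
  by rewrite rec subrr.
rewrite normrM mulrC ler_pM//; last first.
  by rewrite normrM ler_piMr// schur_right_le1.
rewrite (le_trans (ler_normD _ _))// normr1 lerD2l normrM mulr_ile1//.
  by rewrite ltW// disk_lt1.
exact: schur_right_le1.
Qed.

Lemma schur_left_bound a z k : `|z| < 1 ->
  `|schur_left a z k - (a k : R[i])| <= 2 * `|z|.
Proof.
move=> z1; have rec := schur_left_rec a k z1.
have -> : schur_left a z k - (a k : R[i]) =
    z * schur_left a z (k - 1) * (1 - (a k : R[i])^* * schur_left a z k).
  apply/subr0_eq; move: rec; set al := disk_val _; set ac := al^* => rec.
  transitivity (schur_left a z k * (1 + ac * (z * schur_left a z (k - 1))) -
    (z * schur_left a z (k - 1) + al)); first by ring.
  by rewrite rec subrr.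
rewrite normrM mulrC ler_pM//; last first.
  by rewrite normrM ler_piMr// schur_left_le1.
rewrite (le_trans (ler_normB _ _))// normr1 lerD2l normrM mulr_ile1//.
  by rewrite norm_conjC ltW// disk_lt1.
exact: schur_left_le1.
Qed.

Lemma schur_right0 a k : schur_right a 0 k = - (a (k + 1) : R[i])^*.
Proof.
have := @schur_right_bound a 0 k; rewrite normr0 mulr0 => /(_ ltr01).
by rewrite normr_le0 addr_eq0 => /eqP.
Qed.

Lemma schur_left0 a k : schur_left a 0 k = a k.
Proof.
have := @schur_left_bound a 0 k; rewrite normr0 mulr0 => /(_ ltr01).
by rewrite normr_le0 subr_eq0 => /eqP.
Qed.

Lemma near_punctured (P : R[i] -> Prop) :
  (forall z, `|z| < 1 -> z != 0 -> P z) -> \forall z \near (0 : R[i]^o)^', P z.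
Proof.
move=> H; rewrite near_withinE.
by apply: filterS (@nbhs0_lt _ R[i]^o _ ltr01) => z z1; exact: H.
Qed.

Lemma near_le_eq0 (c b : R[i]) : 0 < b ->
  (\forall z \near (0 : R[i]^o)^', `|c| <= b * `|z|) -> c = 0.
Proof.
move=> b0 cP; apply/eqP/negPn/negP => c0.
have cb : 0 < `|c| / b by rewrite divr_gt0// normr_gt0.
have /filter_ex[z []] : \forall z \near (0 : R[i]^o)^',
    `|c| <= b * `|z| /\ `|z| < `|c| / b.
  by apply: filterI => //; exact: (@dnbhs0_lt _ R[i]^o).
by rewrite ltr_pdivlMr// mulrC => /le_lt_trans /[apply]; rewrite ltxx.
Qed.

(** The neighbourhood is punctured because each Schur step divides by [z]. *)
Definition near_eq (F G : R[i] -> R[i]) :=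
  \forall z \near (0 : R[i]^o)^', F z = G z.

(** By [schur_right_bound] the two coefficients differ by at most [4 |z|] for all small [z], hence
    agree; the recursion is then solved for [z phi_(k+1)]. *)
Lemma schur_right_step a1 a2 k :
  near_eq (schur_right a1 ^~ k) (schur_right a2 ^~ k) ->
  a1 (k + 1) = a2 (k + 1) /\
  near_eq (schur_right a1 ^~ (k + 1)) (schur_right a2 ^~ (k + 1)).
Proof.
move=> eq12; have eqa : a1 (k + 1) = a2 (k + 1).
  apply/val_inj/subr0_eq; rewrite -[_ - _]conjCK.
  rewrite (_ : (_ - _)^* = 0) ?conjC0//.
  apply: (@near_le_eq0 _ 4 _); first by rewrite ltr0n.
  apply: filter_app eq12; apply: near_punctured => z z1 z0 /= e.
  have -> : ((a1 (k + 1) : R[i]) - (a2 (k + 1) : R[i]))^* =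
      schur_right a1 z k + (a1 (k + 1) : R[i])^* -
      (schur_right a2 z k + (a2 (k + 1) : R[i])^*).
    by rewrite e rmorphB; ring.
  have -> : 4 * `|z| = 2 * `|z| + 2 * `|z| by ring.
  by rewrite (le_trans (ler_normB _ _))// lerD// schur_right_bound.
split=> //; apply: filter_app eq12; apply: near_punctured => z z1 z0 /= e.
have := schur_right_rec a1 (k + 1) z1; have := schur_right_rec a2 (k + 1) z1.
rewrite addrK e eqa => e2 e1.
have D0 : 1 - (a2 (k + 1) : R[i]) * - schur_right a2 z k != 0.
  by apply: one_sub_disk_neq0; rewrite normrN schur_right_le1.
apply: (mulfI z0); apply: (mulIf D0); apply/subr0_eq; move: e1 e2.
move: (schur_right a1 z _) (schur_right a2 z _) (schur_right a2 z _).
set al := disk_val _; set ac := al^* => p1 p2 p e1 e2.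
transitivity ((p * (1 - al * (z * p2)) - (z * p2 - ac)) -
  (p * (1 - al * (z * p1)) - (z * p1 - ac))); first by ring.
by rewrite e1 e2 !subrr.
Qed.

Lemma schur_left_step a1 a2 k :
  near_eq (schur_left a1 ^~ k) (schur_left a2 ^~ k) ->
  a1 k = a2 k /\
  near_eq (schur_left a1 ^~ (k - 1)) (schur_left a2 ^~ (k - 1)).
Proof.
move=> eq12; have eqa : a1 k = a2 k.
  apply/val_inj/subr0_eq; apply: (@near_le_eq0 _ 4 _); first by rewrite ltr0n.
  apply: filter_app eq12; apply: near_punctured => z z1 z0 /= e.
  have -> : (a1 k : R[i]) - (a2 k : R[i]) =
      (schur_left a2 z k - (a2 k : R[i])) - (schur_left a1 z k - (a1 k : R[i])).
    by rewrite e; ring.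
  have -> : 4 * `|z| = 2 * `|z| + 2 * `|z| by ring.
  by rewrite (le_trans (ler_normB _ _))// lerD// schur_left_bound.
split=> //; apply: filter_app eq12; apply: near_punctured => z z1 z0 /= e.
have := schur_left_rec a1 k z1; have := schur_left_rec a2 k z1.
rewrite e eqa => e2 e1.
have D0 : 1 + (a2 k : R[i])^* * - schur_left a2 z k != 0.
  by apply: one_add_disk_neq0; rewrite normrN schur_left_le1.
apply: (mulfI z0); apply: (mulIf D0); apply/subr0_eq; move: e1 e2.
move: (schur_left a1 z _) (schur_left a2 z (k - 1)) (schur_left a2 z k).
set al := disk_val _; set ac := al^* => p1 p2 p e1 e2.
transitivity ((p * (1 + ac * (z * p2)) - (z * p2 + al)) -
  (p * (1 + ac * (z * p1)) - (z * p1 + al))); first by ring.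
by rewrite e1 e2 !subrr.
Qed.

Lemma schur_determines a1 a2 k :
  near_eq (schur_right a1 ^~ k) (schur_right a2 ^~ k) ->
  near_eq (schur_left a1 ^~ k) (schur_left a2 ^~ k) -> a1 = a2.
Proof.
move=> er el.
have erP (n : nat) :
    near_eq (schur_right a1 ^~ (k + n%:Z)) (schur_right a2 ^~ (k + n%:Z)).
  elim: n => [|n /schur_right_step[_]]; first by rewrite addr0.
  by rewrite (_ : k + n%:Z + 1 = k + n.+1%:Z)//; lia.
have elP (n : nat) :
    near_eq (schur_left a1 ^~ (k - n%:Z)) (schur_left a2 ^~ (k - n%:Z)).
  elim: n => [|n /schur_left_step[_]]; first by rewrite subr0.
  by rewrite (_ : k - n%:Z - 1 = k - n.+1%:Z)//; lia.
apply/funext => j; have [kj|jk] := ltP k j.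
  have [+ _] := schur_right_step (erP (absz (j - k - 1)%R)).
  by rewrite (_ : k + _ + 1 = j)//; lia.
have [+ _] := schur_left_step (elP (absz (k - j)%R)).
by rewrite (_ : k - _ = j)//; lia.
Qed.

(** The formula for [h] gives [phi_k], then the one for [g] gives [psi_k] after division by [phi_k],
    which is close to [- conj alpha_(k+1)]. *)
Lemma schur_data_determines a1 a2 k :
  near_eq (green_g a1 ^~ k) (green_g a2 ^~ k) ->
  near_eq (green_h a1 ^~ k) (green_h a2 ^~ k) ->
  a1 k = a2 k -> (a1 (k + 1) : R[i]) != 0 -> a1 = a2.
Proof.
move=> eg eh ea an0.
have er : near_eq (schur_right a1 ^~ k) (schur_right a2 ^~ k).
  apply: filter_app eh; apply: filter_app eg.
  apply: near_punctured => z z1 _ /= eg eh.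
  apply: (mulIf (one_add_green_g_neq0 a1 k z1)).
  rewrite -green_h_schur// [in RHS]eg -green_h_schur// eg eh.
  by rewrite /rho ea.
apply: (schur_determines er).
(* Below this radius [2 |z| < |alpha_(k+1)|], so [schur_right_bound] excludes a zero of [phi_k]. *)
have a0 : 0 < `|(a1 (k + 1) : R[i])| / 2 by rewrite divr_gt0 ?normr_gt0.
have small : \forall z \near (0 : R[i]^o)^', `|z| < `|(a1 (k + 1) : R[i])| / 2.
  exact: (@dnbhs0_lt _ R[i]^o).
apply: filter_app er; apply: filter_app eg; apply: filter_app small.
apply: near_punctured => z z1 z0 zs /= eg er.
have p0 : schur_right a1 z k != 0.
  move: zs; rewrite ltr_pdivlMr// mulrC; apply: contraTneq => p0.
  have := schur_right_bound a1 k z1; rewrite p0 add0r norm_conjC.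
  by apply: contraL => /lt_geF ->.
apply: (mulfI p0); apply: (mulIf (one_add_green_g_neq0 a1 k z1)).
by rewrite -green_g_schur// er [in RHS]eg -green_g_schur.
Qed.

Lemma green0 a k :
  green_g a 0 k = - (a (k + 1) : R[i])^* * (a k : R[i]) /\
  green_h a 0 k = - (a (k + 1) : R[i])^* * rho a k.
Proof.
have z1 : `|0 : R[i]| < 1 by rewrite normr0.
have := green_g_schur a k z1; have := green_h_schur a k z1.
rewrite schur_right0 schur_left0 !mul0r !addr0 !mulr1 => + gE.
rewrite gE => hE; split=> //.
apply: (mulfI (negbT (gt_eqF (rho_gt0 a k)))); apply/subr0_eq.
move: hE (rho2 a k); move: (green_h a 0 k) (rho a k) => h r.
set al := disk_val (a k); set be := (disk_val (a (k + 1)))^*.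
set ac := al^* => hE r2.
transitivity (r * h + ac * (- be * al) - - be + be * (r ^+ 2 - (1 - al * ac))).
  by ring.
by rewrite hE r2 !subrr mulr0 addr0.
Qed.

(** Multiplying the last hypothesis by its conjugate gives [|x|^2 (1 - |y|^2) = |y|^2 (1 - |x|^2)],
    hence [r = s]. *)
Lemma disk_eq_of_rho (x y : R[i]) (r s : R[i]) : 0 < r -> 0 < s ->
  r ^+ 2 = 1 - x * x^* -> s ^+ 2 = 1 - y * y^* -> x * s = y * r -> x = y.
Proof.
move=> r0 s0 r2 s2 e.
have ec : x^* * s = y^* * r.
  have := congr1 Num.conj e; rewrite !rmorphM /=.
  by rewrite (conj_Creal (gtr0_real r0)) (conj_Creal (gtr0_real s0)).
have rs : r = s.
  apply/eqP; rewrite -(eqrXn2 (n := 2)) ?(ltW r0) ?(ltW s0)//; apply/eqP.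
  apply/subr0_eq; transitivity
    (r ^+ 2 * (1 - y * y^* - s ^+ 2) - s ^+ 2 * (1 - x * x^* - r ^+ 2) -
     (x * s * (x^* * s) - y * r * (y^* * r))); first by ring.
  by rewrite e ec r2 s2 !subrr !mulr0 !subr0.
by move: e; rewrite rs => /(mulIf (negbT (gt_eqF s0))).
Qed.

(** By [green0], [g / h] at [0] equals [alpha_k / rho_k], and this quotient determines [alpha_k]. *)
Lemma green_pair_determines a1 a2 k :
  green_h a1 0 k != 0 ->
  green_g a1 0 k = green_g a2 0 k -> green_h a1 0 k = green_h a2 0 k ->
  near_eq (green_g a1 ^~ k) (green_g a2 ^~ k) ->
  near_eq (green_h a1 ^~ k) (green_h a2 ^~ k) -> a1 = a2.
Proof.
move=> h0 g12 h12 eg eh; have [gE1 hE1] := green0 a1 k.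
have [gE2 hE2] := green0 a2 k.
have an0 : (a1 (k + 1) : R[i]) != 0.
  by apply: contra_neq h0 => an0; rewrite hE1 an0 conjC0 oppr0 mul0r.
apply: (schur_data_determines eg eh _ an0); apply: val_inj => /=.
apply: (disk_eq_of_rho (rho_gt0 a1 k) (rho_gt0 a2 k)); [exact: rho2..|].
have h20 : green_h a2 0 k != 0 by rewrite -h12.
have b0 : - (a1 (k + 1) : R[i])^* * - (a2 (k + 1) : R[i])^* != 0.
  rewrite mulf_neq0//; first by move: h0; rewrite hE1; apply: contra_neq => ->;
    rewrite mul0r.
  by move: h20; rewrite hE2; apply: contra_neq => ->; rewrite mul0r.
apply: (mulfI b0); rewrite mulrACA -gE1 -hE2 -h12 g12 hE1 gE2.
by ring.
Qed.

(* With [X = al * z * phi k] and [Y = conj al * psi k], the product [X * Y] is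
   fixed by [green_g] at [k] and the sum [X + Y] by [green_g] at [k - 1]; for
   small [z] the two roots are told apart by [X = O(z)], [Y = |al|^2 + O(z)]. *)
Lemma green_neighbours_determine a1 a2 k :
  (a1 k : R[i]) != 0 -> a1 k = a2 k ->
  near_eq (green_g a1 ^~ (k - 1)) (green_g a2 ^~ (k - 1)) ->
  near_eq (green_g a1 ^~ k) (green_g a2 ^~ k) -> a1 = a2.
Proof.
move=> a0 ea eg' eg.
(* The threshold makes [3 |z| < |al|]: one [|z|] comes from [X], two from [schur_left_bound]. *)
have small : \forall z \near (0 : R[i]^o)^', `|z| < `|a1 k : R[i]| / 3.
  by apply: (@dnbhs0_lt _ R[i]^o); rewrite divr_gt0 ?normr_gt0.
suff H : \forall z \near (0 : R[i]^o)^',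
    schur_right a1 z k = schur_right a2 z k /\
    schur_left a1 z k = schur_left a2 z k.
  by apply: (@schur_determines _ _ k); apply: filterS H => z [].
apply: filter_app eg; apply: filter_app eg'; apply: filter_app small.
apply: near_punctured => z z1 z0 zs /= eg' eg.
have prodE j : green_g a1 z j = green_g a2 z j ->
    schur_right a1 z j * schur_left a1 z j =
    schur_right a2 z j * schur_left a2 z j.
  move=> e; apply: (mulIf (one_add_green_g_neq0 a1 j z1)).
  by rewrite -green_g_schur// [in RHS]e -green_g_schur.
have := prodE _ eg; have := prodE _ eg'.
have Q1 : `|schur_right a1 z (k - 1) * schur_left a1 z (k - 1)| <= 1.
  by rewrite normrM mulr_ile1// ?schur_right_le1 ?schur_left_le1.
have Q0 := one_sub_neq0 z1 Q1.
have p1 := schur_right_le1 a1 k z1.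
have bq := schur_left_bound a2 k z1.
move: (schur_right_rec a1 k z1) (schur_right_rec a2 k z1)
  (schur_left_rec a1 k z1) (schur_left_rec a2 k z1) p1 bq Q0.
rewrite -ea; set al := disk_val (a1 k); set ac := al^*.
move: (schur_right a1 z k) (schur_right a2 z k) (schur_left a1 z k)
  (schur_left a2 z k) (schur_right a1 z (k - 1)) (schur_right a2 z (k - 1))
  (schur_left a1 z (k - 1)) (schur_left a2 z (k - 1)).
move=> p1 p2 q1 q2 p1' p2' q1' q2' rp1 rp2 rq1 rq2 p11 bq Q0 eP' eP.
(* The two recursions combine so that [X + Y] depends only on the products [phi psi] at [k] and
   [k - 1], which [prodE] recovers from [g]. *)
have sumE p q p' q' : p' * (1 - al * (z * p)) = z * p - ac ->
    q * (1 + ac * (z * q')) = z * q' + al ->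
    (al * (z * p) + ac * q) * (1 - z * (p' * q')) =
    z * (p * q) + al * ac - z * (p' * q') * (1 + al * ac * (z * (p * q))).
  move=> rp rq; apply/subr0_eq; transitivity
    ((1 - ac * q) * z * q' * (p' * (1 - al * (z * p)) - (z * p - ac)) -
     (z * p - ac) * (q * (1 + ac * (z * q')) - (z * q' + al))); first by ring.
  by rewrite rp rq !subrr !mulr0 subr0.
have sum12 : al * (z * p1) + ac * q1 = al * (z * p2) + ac * q2.
  by apply: (mulIf Q0); rewrite (sumE _ _ _ _ rp1 rq1) eP' eP -sumE.
have X12 : al * (z * p1) - ac * q2 != 0.
  rewrite subr_eq0; apply/eqP => XY.
  have N : al * ac = al * (z * p1) - ac * (q2 - al).
    by rewrite XY; ring.
  have : `|al| * `|al| <= `|al| * (`|z| * 3).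
    rewrite -{2}(norm_conjC al) -/ac -normrM N (le_trans (ler_normB _ _))//.
    rewrite !normrM norm_conjC -mulrDr ler_wpM2l//.
    have -> : `|z| * 3 = `|z| + 2 * `|z| by ring.
    by rewrite lerD// ler_piMr.
  rewrite ler_pM2l ?normr_gt0// => /le_lt_trans.
  by move: zs; rewrite ltr_pdivlMr// => zs /(_ _ zs); rewrite ltxx.
have al0 : al * z != 0 by rewrite mulf_neq0.
(* Equal sums and products give [(X1 - X2) * (X1 - Y2) = 0], and [X12] excludes the second
   factor. *)
have p12 : p1 = p2.
  apply: (mulfI al0); apply: (mulfI X12); apply/subr0_eq.
  transitivity (al * (z * p1) * (al * (z * p1) + ac * q1 -
    (al * (z * p2) + ac * q2)) - al * ac * z * (p1 * q1 - p2 * q2)).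
    by ring.
  by rewrite sum12 eP !subrr !mulr0 subrr.
split=> //; move: sum12; rewrite p12 => /addrI.
by apply: mulfI; rewrite conjC_eq0.
Qed.

End SchurAlgorithm.

Theorem theorem1p3 (R : realType) (a1 a2 : int -> unit_disk R) (k0 : int) :
  ([/\ green_h a1 0 k0 != 0, green_h a2 0 k0 != 0 &
      \forall z \near (0 : R[i]^o),
        green_g a1 z k0 = green_g a2 z k0 /\ green_h a1 z k0 = green_h a2 z k0]
   \/
   [/\ (a1 k0 : R[i]) != 0, (a2 k0 : R[i]) != 0, (a1 k0 : R[i]) = a2 k0 &
      \forall z \near (0 : R[i]^o),
        green_g a1 z (k0 - 1) = green_g a2 z (k0 - 1) /\
        green_g a1 z k0 = green_g a2 z k0]) ->
  (forall k : int, (a1 k : R[i]) = a2 k) /\ CMV a1 = CMV a2.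
Proof.
move=> data; suff -> : a1 = a2 by [].
case: data => [[h0 _ eq12]|[a0 _ /val_inj ea eq12]].
  (* The values at [0] itself are kept to recover [alpha_k0]; the rest uses punctured
     neighbourhoods. *)
  have [g12 h12] := nbhs_singleton eq12.
  apply: (green_pair_determines h0 g12 h12).
    by apply: nbhs_dnbhs; apply: filterS eq12 => z [].
  by apply: nbhs_dnbhs; apply: filterS eq12 => z [].
apply: (green_neighbours_determine a0 ea).
  by apply: nbhs_dnbhs; apply: filterS eq12 => z [].
by apply: nbhs_dnbhs; apply: filterS eq12 => z [].
Qed.
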